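(* Under the assumptions of the Black–Scholes model, the European call option price $C(Z_\delta,\delta)$, relative to the stock price variation $Z_\delta=z$, with short rate $r$, inhibition degree parameter $\beta$, and strike price $K$, satisfies the partial differential equation $$\frac{\partial C}{\partial\delta}+rz\frac{\partial C}{\partial z}+\frac12B_\delta^2\frac{\partial^2C}{\partial z^2}-rC=0,\qquad 0<|z|<\infty,\quad 0<\delta<\delta_T=T-0,$$ where $$B_\delta=\frac{q}{\delta^{\beta-1}}+\frac{\sigma}{\delta^\beta},\qquad q=\mu-\frac12\sigma^2,$$ together with the conditions $C(0,\delta)=0$ and $C(z,\delta_T)=(|z|-\ln K)^+$.
   Context: The stock price is the geometric Brownian motion $S_t=S_0\exp\{(\mu-\frac12\sigma^2)t+\sigma W_t\}$, with constants $\mu,\sigma$ and a standard Wiener process $W_t$; $\beta>\frac32$ and $q=\mu-\frac12\sigma^2$. Applying the ergodic maker operator to $\ln S_t$ on a time interval of length $\delta$ in $[0,T]$ gives $Z_\delta=\frac{q\,\delta\,W_T}{T^\beta}+\frac{\sigma W_\delta}{T^\beta}$, $Z_0=0$. Taking $\delta=T-0=T$, so that $Z_\delta=\frac{qW_\delta}{\delta^{\beta-1}}+\frac{\sigma W_\delta}{\delta^\beta}$, Itô's lemma gives $$dZ_\delta=A(\delta,W_\delta)\,d\delta+B_\delta\,dW_\delta,\qquad A(\delta,W_\delta)=\frac{qW_\delta}{\delta^\beta}-\frac{\beta}{\delta}Z_\delta .$$ $Z_\delta$ is regarded as the process of variations of the price of a traded stock: it is the underlying in which positions are held and on which the call option is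 written, the option being exercised when $|z|>\ln K$. The Black–Scholes assumptions are the usual ones: constant short rate $r$, continuous frictionless trading, absence of arbitrage (a self-financing portfolio of value $V_\delta$ with no $dW_\delta$ term satisfies $dV_\delta=rV_\delta\,d\delta$), and an option price given by a function $C(z,\delta)$ smooth enough for Itô's lemma.
   Formalization: The condition C(0,δ)=0, which does not follow from the Black–Scholes assumptions, and the terminal payoff are taken as data of the option contract; the degenerate case μ=σ=0 (where Z vanishes identically) is excluded. *)

(* Defs.v *)
From HB Require Import structures.
From mathcomp Require Import all_boot all_order all_algebra.
From mathcomp Require Import all_classical all_reals all_analysis.
Set Implicit Arguments.
Unset Strict Implicit.
Unset Printing Implicit Defensive.
Import Order.TTheory GRing.Theory Num.Theory.
Import numFieldNormedType.Exports.
Local Open Scope classical_set_scope.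
Local Open Scope ring_scope.

Section stochastic_calculus.
Context {R : realType} {d : measure_display} {Omega : measurableType d}
        {P : probability Omega R}.
Implicit Types (W : R -> {RV P >-> R}) (H X V a b : R -> Omega -> R).

(* Standard Wiener process on [0, +oo[.  The increment over [s, t] is centred
   Gaussian with standard deviation sqrt (t - s): the second parameter of
   [normal_prob] is a standard deviation, not a variance. *)
Definition wiener_process W : Prop :=
  [/\ forall w, W 0 w = 0,
      forall w, {within `[0, +oo[, continuous (fun t => W t w)},
      forall s t, 0 <= s -> s < t -> forall A : set R, measurable A ->
        P ((fun w => W t w - W s w) @^-1` A) =
        normal_prob 0 (Num.sqrt (t - s)) A &
      forall (n : nat) (t : nat -> R) (A : nat -> set R),
        0 <= t 0%N -> (forall i, t i <= t i.+1) ->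
        (forall i, measurable (A i)) ->
        let E i := (fun w => W (t i.+1) w - W (t i) w) @^-1` A i in
        P [set w | forall i, (i < n)%N -> E i w] =
        (\prod_(i < n) P (E i))%E].

(* The sigma-algebra generated by the W_v, 0 <= v <= u. *)
Definition natural_filtration W (u : R) : set (set Omega) :=
  <<s [set E | exists v (A : set R),
        [/\ 0 <= v, v <= u, measurable A & E = W v @^-1` A]] >>.

Definition continuous_adapted W (s t : R) X : Prop :=
  (forall u, s <= u <= t -> forall A : set R, measurable A ->
     natural_filtration W u (X u @^-1` A)) /\
  (forall w, {within `[s, t], continuous (fun u => X u w)}).

(* For a partition s = p_0 < p_1 < ... < p_n = t, encoded as in
   [itv_partition] by the sequence l = [:: p_1; ...; p_n]:
   \sum_k H_(p_k) (X_(p_(k+1)) - X_(p_k)). *)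
Definition left_sum H X (s : R) (l : seq R) (w : Omega) : R :=
  let p := nth s (s :: l) in
  \sum_(k < size l) H (p k) w * (X (p k.+1) w - X (p k) w).

(* Convergence in probability along the partitions of [s, t] as the mesh
   tends to 0. *)
Definition cvg_in_prob_mesh (s t : R) (S : seq R -> Omega -> R)
    (I : Omega -> R) : Prop :=
  forall e : R, 0 < e -> exists2 h : R, 0 < h &
    forall l : seq R, itv_partition s t l ->
      path (fun x y => y - x < h) s l ->
      (P [set w | (e <= `|S l w - I w|)%R] <= e%:E)%E.

(* I = \int_s^t H dX.  For a continuous adapted integrand and a continuous
   semimartingale, the Ito integral is the limit in probability of the
   left-point sums. *)
Definition is_ito_integral H X (s t : R) (I : Omega -> R) : Prop :=
  measurable_fun setT I /\ cvg_in_prob_mesh s t (left_sum H X s) I.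

(* dV = a du + b dW on [s0, t0]. *)
Definition ito_differential W V a b (s0 t0 : R) : Prop :=
  forall s t, s0 <= s -> s <= t -> t <= t0 ->
    exists2 I : Omega -> R, is_ito_integral b (fun u => W u) s t I &
      {ae P, forall w, V t w - V s w =
        \int[lebesgue_measure]_(u in `[s, t]) a u w + I w}.

End stochastic_calculus.

Section market.
Context {R : realType} {d : measure_display} {Omega : measurableType d}
        {P : probability Omega R}.
Variables (W : R -> {RV P >-> R}) (mu sigma beta r T : R).
Variable C : R -> R -> R. (* C z delta *)

Definition drift_q : R := mu - sigma ^+ 2 / 2.

Definition B_coef (u : R) : R :=
  drift_q / u `^ (beta - 1) + sigma / u `^ beta.

(* At u = 0 this is 0, since W_0 = 0. *)
Definition Z_process (u : R) (w : Omega) : R :=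
  drift_q * W u w / u `^ (beta - 1) + sigma * W u w / u `^ beta.

Definition option_process (u : R) (w : Omega) : R := C (Z_process u w) u.

Definition bank_account (u : R) (w : Omega) : R := expR (r * u).

(* A portfolio holds phi options, psi units of the underlying and eta units
   of the bank account. *)
Definition portfolio_value (phi psi eta : R -> Omega -> R)
    (u : R) (w : Omega) : R :=
  phi u w * option_process u w + psi u w * Z_process u w +
  eta u w * bank_account u w.

(* dV = phi dC + psi dZ + eta dM: the change of value is the limit of the gains
   of trading at finitely many dates.  The three integrals are taken jointly,
   i.e. as the integral of a vector integrand. *)
Definition self_financing (phi psi eta : R -> Omega -> R) (s0 t0 : R) : Prop :=
  let V := portfolio_value phi psi eta in
  forall s t, s0 <= s -> s <= t -> t <= t0 ->
    cvg_in_prob_mesh (P := P) s t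
      (fun l w => left_sum phi option_process s l w +
                  left_sum psi Z_process s l w +
                  left_sum eta bank_account s l w)
      (fun w => V t w - V s w).

(* Every self-financing portfolio held over a period [s0, t0] inside ]0, T[
   whose value has no dW term satisfies dV = r V du. *)
Definition no_arbitrage : Prop :=
  forall (s0 t0 : R) (phi psi eta a : R -> Omega -> R),
    0 < s0 -> s0 <= t0 -> t0 < T ->
    continuous_adapted W s0 t0 phi ->
    continuous_adapted W s0 t0 psi ->
    continuous_adapted W s0 t0 eta ->
    continuous_adapted W s0 t0 a ->
    self_financing phi psi eta s0 t0 ->
    let V := portfolio_value phi psi eta in
    ito_differential W V a (fun _ _ => 0) s0 t0 ->
    ito_differential W V (fun u w => r * V u w) (fun _ _ => 0) s0 t0.

End market.

Section option_price.
Context {R : realType}.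
Implicit Types (C : R -> R -> R).

Definition partial_z C (z u : R) : R := derive1 (fun x => C x u) z.
Definition partial_t C (z u : R) : R := derive1 (C z) u.

(* C is of class C^(2,1) on the region z != 0, 0 < u < T.  Nothing is required
   across z = 0: a classical solution of the equation on the whole line which is
   continuous up to u = T cannot satisfy both C 0 u = 0 and the terminal
   condition. *)
Definition ito_smooth (T : R) C : Prop :=
  forall z u : R, 0 < `|z| -> 0 < u < T ->
    [/\ derivable (C z) u 1,
        derivable (fun x => C x u) z 1 &
        derivable (fun x => partial_z C x u) z 1] /\
    [/\ {for (z, u), continuous (fun p : R * R => partial_t C p.1 p.2)},
        {for (z, u), continuous (fun p : R * R => partial_z C p.1 p.2)} &
        {for (z, u), continuous
           (fun p : R * R => partial_z (partial_z C) p.1 p.2)}].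

(* The holder exercises when |z| > ln K. *)
Definition call_payoff (K z : R) : R :=
  if ln K < `|z| then `|z| - ln K else 0.

(* The data of the option contract: the payoff at expiry T, and the value 0
   when the price variation vanishes before expiry. *)
Definition call_contract (T K : R) C : Prop :=
  (forall z, C z T = call_payoff K z) /\
  (forall u, 0 < u < T -> C 0 u = 0).

End option_price.

(* Main.v *)
Require Import Defs.
From mathcomp Require Import all_boot all_order all_algebra.
From mathcomp Require Import all_classical all_reals all_analysis.
From mathcomp Require Import measurable_realfun ring lra.
Import Order.TTheory GRing.Theory Num.Theory.
Import numFieldNormedType.Exports.
Set Implicit Arguments.
Unset Strict Implicit.
Unset Printing Implicit Defensive.
Local Open Scope classical_set_scope.
Local Open Scope ring_scope.

(** Write Z_u = B_u W_u for the price variation, and G(z, u) for the left-hand side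
    of the equation. The argument is the one of Black and Scholes, made quantitative
    by the choice of the number of options held. Suppose that an agent holds
    phi = chi(Z) G(Z, u) options, where chi is a continuous cutoff vanishing near
    z = 0, and - phi C_z(Z, u) units of the underlying, and keeps the rest of a
    wealth V in the bank account. By the Ito formula the portfolio is self-financing
    exactly when V solves dV = (r V + chi(Z) G(Z, u)^2) du, an ordinary differential
    equation along each path, with an explicit adapted solution. The value has no dW
    term, so absence of arbitrage gives dV = r V du as well, whence
    int chi(Z) G(Z, u)^2 du = 0 almost surely [no_arbitrage_ae]. The integrand is
    continuous and nonnegative, so it vanishes at every date. Since Z_u has a
    Gaussian law of full support as soon as B_u <> 0, G vanishes off z = 0 at those
    dates [pde_lhs_eq0_B_neq0]; as B has at most one zero, continuity of G in time
    gives the equation everywhere [pde_lhs_eq0]. The boundary conditions are those of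
    the contract.

    The Ito formula is proved in the form needed, in the manner of Foellmer. A
    deterministic statement [hedge_gains_cvg] says that along a sequence of
    partitions the gains converge for every continuous path W such that, for each
    step weight f of a countable family, the sums of f(u) ((W_v - W_u)^2 - (v - u))
    over the cells [u, v] tend to 0; it only uses Taylor expansions and uniform
    continuity, with no bounds that are uniform over paths. Brownian paths have this
    property almost surely along partitions of mesh at most 8^-n
    [ae_step_qv_cvg0]: the deviations (W_v - W_u)^2 - (v - u) are centred and
    pairwise uncorrelated, with variance at most 32 (v - u)^2, so that Chebyshev's
    inequality and the Borel-Cantelli lemma apply. Almost sure convergence along all
    such sequences implies the convergence in probability as the mesh tends to 0
    that defines self-financing portfolios [cvg_in_prob_mesh_of_ae]. *)

(** * Sums over partitions *)

Section partition_sums.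
Context {R : realType}.
Implicit Types (s t u v h : R) (l : seq R) (F G : R -> R -> R).

(** Riemann and Ito sums are both of this form: F u v is the contribution of the
    cell [u, v] of the partition s :: l. *)
Definition partition_sum F s l : R :=
  \sum_(k < size l) F (nth s (s :: l) k) (nth s (s :: l) k.+1).

Definition mesh_lt h s l : bool := path (fun x y => y - x < h) s l.

Lemma psum_nil F s : partition_sum F s [::] = 0.
Proof. by rewrite /partition_sum big_ord0. Qed.

Lemma psum_cons F s x l : partition_sum F s (x :: l) = F s x + partition_sum F x l.
Proof.
rewrite /partition_sum /= big_ord_recl /=; congr (_ + _).
apply: eq_bigr => i _ /=.
rewrite add0n (set_nth_default x s (s := l))//.
by rewrite (set_nth_default x s (s := x :: l))//= ltnS ltnW.
Qed.

Lemma psumD F G s l : partition_sum (fun u v => F u v + G u v) s l = partition_sum F s l + partition_sum G s l.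
Proof. by rewrite /partition_sum big_split. Qed.

Lemma psumB F G s l : partition_sum (fun u v => F u v - G u v) s l = partition_sum F s l - partition_sum G s l.
Proof. by rewrite /partition_sum sumrB. Qed.

Lemma psumZ c F s l : partition_sum (fun u v => c * F u v) s l = c * partition_sum F s l.
Proof. by rewrite /partition_sum mulr_sumr. Qed.

Lemma psum_telescope (f : R -> R) s t l : itv_partition s t l ->
  partition_sum (fun u v => f v - f u) s l = f t - f s.
Proof.
elim: l s => [s /itv_partition_nil ->|x l ih s slt]; first by rewrite psum_nil subrr.
by rewrite psum_cons (ih x (itv_partition_cons slt)); ring.
Qed.

Lemma itv_partition_step s t x l : itv_partition s t (x :: l) ->
  [/\ s < x, x <= t & itv_partition x t l].
Proof.
move=> slt; have xl := itv_partition_cons slt; split=> //.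
  by case: slt => /= /andP[].
exact: itv_partition_le xl.
Qed.

Lemma psum_le_mesh F G h s t l : itv_partition s t l -> mesh_lt h s l ->
  (forall u v, s <= u -> u < v -> v <= t -> v - u < h -> F u v <= G u v) ->
  partition_sum F s l <= partition_sum G s l.
Proof.
elim: l s => [s _ _ _|x l ih s slt]; first by rewrite !psum_nil.
have [sx xt xl] := itv_partition_step slt.
move=> /= /andP[sxh xlh] FG; rewrite !psum_cons lerD ?FG//.
by apply: ih => // u v xu; apply: FG; rewrite (le_trans (ltW sx)).
Qed.

Lemma psum_le F G s t l : itv_partition s t l ->
  (forall u v, s <= u -> u < v -> v <= t -> F u v <= G u v) ->
  partition_sum F s l <= partition_sum G s l.
Proof.
elim: l s => [s _ _|x l ih s slt FG]; first by rewrite !psum_nil.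
have [sx xt xl] := itv_partition_step slt.
rewrite !psum_cons lerD ?FG//.
by apply: ih => // u v xu; apply: FG; rewrite (le_trans (ltW sx)).
Qed.

Lemma eq_psum F G s t l : itv_partition s t l ->
  (forall u v, s <= u -> u < v -> v <= t -> F u v = G u v) ->
  partition_sum F s l = partition_sum G s l.
Proof.
elim: l s => [s _ _|x l ih s slt FG]; first by rewrite !psum_nil.
have [sx xt xl] := itv_partition_step slt.
rewrite !psum_cons FG//; congr (_ + _); apply: ih => // u v xu; apply: FG.
by rewrite (le_trans (ltW sx)).
Qed.

Lemma ler_norm_psum F s l : `|partition_sum F s l| <= partition_sum (fun u v => `|F u v|) s l.
Proof. exact: ler_norm_sum. Qed.

Lemma exists_fine_partition s t h : s <= t -> 0 < h ->
  exists2 l, itv_partition s t l & mesh_lt h s l.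
Proof.
move=> st h0; have [n tn] : exists n : nat, t - s < n%:R * (h / 2).
  exists (Num.truncn ((t - s) / (h / 2))).+1.
  rewrite -ltr_pdivrMr ?divr_gt0//.
  exact: truncnS_gt.
elim: n s st tn => [s st|n ih s st].
  by rewrite mul0r subr_lt0 ltNge st.
move: st; rewrite le_eqVlt => /predU1P[->|st] tn.
  by exists [::] => //; split => /=.
have [tsh|hts] := ltP (t - s) h.
  by exists [:: t]; [exact: itv_partition1|rewrite /mesh_lt /= tsh].
have [||l [pl /eqP ll] ml] := ih (s + h / 2).
- lra.
- move: tn; rewrite -natr1; lra.
exists (s + h / 2 :: l).
  by split => /=; [rewrite pl andbT ltrDl divr_gt0|rewrite ll].
by rewrite /mesh_lt /=; apply/andP; split => //; lra.
Qed.

Lemma near_invX_lt (c e : R) : 1 < c -> 0 < e -> \forall n \near \oo, c ^- n < e.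
Proof.
move=> c1 e0; have c0 := lt_trans ltr01 c1.
have : c^-1 ^+ n @[n --> \oo] --> (0 : R).
  by apply: cvg_expr; rewrite gtr0_norm ?invr_gt0// invf_lt1.
move=> /cvgrPdist_lt/(_ e e0); apply: filterS => n.
by rewrite sub0r normrN exprVn; apply: le_lt_trans; exact: ler_norm.
Qed.

Lemma mesh_lt_near s (l : nat -> seq R) : (forall n, mesh_lt (8 ^- n) s (l n)) ->
  forall h, 0 < h -> \forall n \near \oo, mesh_lt h s (l n).
Proof.
move=> lm h h0; have := near_invX_lt (ltr1n R 8) h0; apply: filterS => n hn.
by apply: sub_path (lm n) => x y xy; exact: lt_trans hn.
Qed.

End partition_sums.

(** * Uniform continuity and mean value estimates *)

Section uniform_continuity.
Context {R : realType}.

(** Heine-Cantor where the second point need not lie in K: an intermediate value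
    given by a mean value theorem stays close to K without belonging to it. *)
Lemma compact_unif_continuous (T : pseudoMetricType R) (K : set T) (f : T -> R) :
  compact K -> (forall p, K p -> {for p, continuous f}) ->
  forall e, 0 < e -> exists2 h : R, 0 < h &
    forall p, K p -> forall q, ball p h q -> `|f q - f p| < e.
Proof.
move=> /compact_near_coveringP cK cf e e0.
have := cK R (0^'+) (fun h p => forall q, ball p h q -> `|f q - f p| < e) _.
case=> [p Kp|h0 /= h00 H].
  have /cvgrPdist_lt /(_ (e / 2)) := cf p Kp.
  rewrite divr_gt0// => /(_ isT) /nbhs_ballP[d /= d0 pd].
  exists (ball p (d / 2), [set h | 0 < h < d / 2]) => /=.
    split; first by apply: nbhsx_ballx; rewrite divr_gt0.
    exists (d / 2) => /=; first by rewrite divr_gt0.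
    by move=> h /=; rewrite sub0r normrN => hd h0; rewrite h0/= (le_lt_trans _ hd)// ler_norm.
  move=> [q h] /= [pq /andP[h0 hd]] q' qq'.
  have pq' : ball p d q'.
    rewrite [d]splitr; apply: ball_triangle pq _.
    exact: le_ball (ltW hd) _ qq'.
  have fq := pd _ pq'.
  have fq0 : `|f p - f q| < e / 2.
    by apply: pd; apply: le_ball pq; lra.
  rewrite (_ : f q' - f q = - (f p - f q') + (f p - f q)); last by ring.
  by rewrite (le_lt_trans (ler_normD _ _))// normrN (splitr e) ltrD.
exists (h0 / 2); first by rewrite divr_gt0.
apply: H; last by rewrite divr_gt0.
by rewrite /= sub0r normrN gtr0_norm ?divr_gt0//; rewrite ltr_pdivrMr//; lra.
Qed.

(** Two-sided continuity, also at the endpoints: one-sided derivatives and limits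
    are then never needed. *)
Definition cts_on (s t : R) (f : R -> R) : Prop :=
  forall u, s <= u <= t -> {for u, continuous f}.

Lemma cts_unif s t f : cts_on s t f -> forall e, 0 < e -> exists2 h : R, 0 < h &
  forall u v, s <= u <= t -> `|v - u| < h -> `|f v - f u| < e.
Proof.
move=> cf e e0.
have [p Kp|h h0 H] := @compact_unif_continuous R `[s, t] f (@segment_compact _ s t) _ e e0.
  by apply: cf; move: Kp; rewrite /= in_itv.
exists h => // u v ust uv; apply: H; first by rewrite /= in_itv.
by rewrite /ball /= distrC.
Qed.

Lemma cts_within s t f : cts_on s t f -> {within `[s, t], continuous f}.
Proof.
move=> cf; apply: continuous_in_subspaceT => u /[!inE]/= /[!in_itv]/= ust.
exact: cf.
Qed.

Lemma cts_bounded s t f : cts_on s t f ->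
  exists2 M : R, 0 < M & forall u, s <= u <= t -> `|f u| <= M.
Proof.
move=> cf; have [ts|st] := ltP t s.
  by exists 1 => // u /andP[su ut]; have := le_trans su ut; rewrite leNgt ts.
have [|c cst H] := @EVT_max R (fun u => `|f u|) s t st.
  apply: cts_within => u ust; apply: continuous_comp; first exact: cf.
  exact: norm_continuous.
exists (`|f c| + 1); first by rewrite ltr_wpDl.
by move=> u ust; rewrite (le_trans (H u _))// ?lerDl// in_itv.
Qed.

Lemma derivable1_continuous (f : R -> R) (u : R) :
  derivable f u 1 -> {for u, continuous f}.
Proof. by move=> df; apply: differentiable_continuous; exact/derivable1_diffP. Qed.

Lemma is_derive1_continuous (f : R -> R) (u df : R) :
  is_derive u 1 f df -> {for u, continuous f}.
Proof. by case=> + _; exact: derivable1_continuous. Qed.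

(** The mean value theorem without an ordering of a and b, as needed for the
    increments of a Brownian path, whose sign is unknown. *)
Lemma mvt_dist (f df : R -> R) (a b : R) :
  (forall y, `|y - a| <= `|b - a| -> is_derive y 1 f (df y)) ->
  exists2 c, `|c - a| <= `|b - a| & f b - f a = df c * (b - a).
Proof.
move=> fdf.
have D y : `|y - a| <= `|b - a| -> derivable f y 1.
  by move=> /fdf [].
have [ab|ba] := leP a b.
  have [|| c cab fc] := @MVT_segment R f df a b ab.
  - move=> y /[!in_itv]/= /andP[ay yb]; apply: fdf.
    by rewrite !ger0_norm ?subr_ge0// ?lerB// ltW.
  - apply: derivable_within_continuous => y /[!in_itv]/= /andP[ay yb]; apply: D.
    by rewrite !ger0_norm ?subr_ge0// lerB.
  exists c => //; move: cab; rewrite in_itv/= => /andP[ac cb].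
  by rewrite !ger0_norm ?subr_ge0// lerB.
have [|| c cab fc] := @MVT_segment R f df b a (ltW ba).
- move=> y /[!in_itv]/= /andP[ay yb]; apply: fdf.
  by rewrite !ler0_norm ?subr_le0 ?(ltW ba) ?(ltW yb)//; lra.
- apply: derivable_within_continuous => y /[!in_itv]/= /andP[ay yb]; apply: D.
  by rewrite !ler0_norm ?subr_le0 ?(ltW ba)//; lra.
exists c.
  move: cab; rewrite in_itv/= => /andP[ac cb].
  by rewrite !ler0_norm ?subr_le0 ?(ltW ba)//; lra.
by rewrite -opprB fc; ring.
Qed.

(** Two uses of the mean value theorem: on f minus its second-order polynomial at
    a, then on the derivative of f. The remainder is thus controlled by the
    oscillation e of the second derivative. *)
Lemma taylor2_dist (f : R -> R) (a b e : R) :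
  (forall y, `|y - a| <= `|b - a| ->
    [/\ derivable f y 1, derivable (derive1 f) y 1 &
        `|(derive1 (derive1 f)) y - (derive1 (derive1 f)) a| <= e]) ->
  `|f b - f a - (derive1 f) a * (b - a) - 1 / 2 * (derive1 (derive1 f)) a * (b - a) ^+ 2|
    <= e * (b - a) ^+ 2.
Proof.
move=> H.
pose k x := f x - (derive1 f) a * (x - a) - 1 / 2 * (derive1 (derive1 f)) a * (x - a) ^+ 2.
pose dk (x : R) : R := (derive1 f) x - (derive1 f) a - (derive1 (derive1 f)) a * (x - a).
have [|c cab kc] := @mvt_dist k dk a b.
  move=> y /H[fy _ _].
  have dfy : is_derive y 1 f ((derive1 f) y) by rewrite derive1E; exact: derivableP.
  by apply: is_derive_eq; rewrite /dk /GRing.scale /=; field.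
have [|d dca fd] := @mvt_dist (derive1 f) (derive1 (derive1 f)) a c.
  move=> y ya; have [_ f'y _] := H y (le_trans ya cab).
  by rewrite derive1E; exact: derivableP.
have [_ _ de] := H d (le_trans dca cab).
rewrite (_ : _ - _ = k b - k a); last by rewrite /k; ring.
rewrite kc /dk fd -mulrBl normrM normrM -mulrA.
rewrite -[(b - a) ^+ 2]ger0_norm ?sqr_ge0// normrX expr2.
have e0 := le_trans (normr_ge0 _) de.
by rewrite ler_pM// ?mulr_ge0// ler_wpM2r.
Qed.

End uniform_continuity.

(** * Error terms of Ito sums and quadratic variation along a path *)

Section ito_small_terms.
Context {R : realType}.
Variables (s t : R) (x : R -> R).
Implicit Types (F G : R -> R -> R) (f g : R -> R).

(** The scale on which the error terms of the Ito expansion are measured: over a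
    partition these quantities add up to at most the length of the interval plus
    the discrete quadratic variation of x, and so stay bounded. *)
Definition ito_size (u v : R) : R := (v - u) + (x v - x u) ^+ 2.

Definition ito_small F : Prop := forall e : R, 0 < e -> exists2 h : R, 0 < h &
  forall u v, s <= u -> u < v -> v <= t -> v - u < h -> `|F u v| <= e * ito_size u v.

Lemma ito_size_ge0 u v : u < v -> 0 <= ito_size u v.
Proof. by move=> uv; rewrite addr_ge0 ?sqr_ge0// subr_ge0 ltW. Qed.

Lemma ito_smallD F G : ito_small F -> ito_small G -> ito_small (fun u v => F u v + G u v).
Proof.
move=> nF nG e e0.
have e20 : 0 < e / 2 by rewrite divr_gt0.
have [h h0 HF] := nF _ e20; have [k k0 HG] := nG _ e20.
exists (Num.min h k) => [|u v su uv vt]; first by rewrite lt_min h0 k0.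
rewrite lt_min => /andP[uvh uvk].
by rewrite (splitr e) mulrDl (le_trans (ler_normD _ _))// lerD ?HF ?HG.
Qed.

Lemma ito_small_dominated F M : 0 < M -> forall G, ito_small F ->
  (forall u v, s <= u -> u < v -> v <= t -> `|G u v| <= M * `|F u v|) -> ito_small G.
Proof.
move=> M0 G nF FG e e0.
have [h h0 HF] := nF (e / M) (divr_gt0 e0 M0).
exists h => // u v su uv vt uvh; rewrite (le_trans (FG _ _ su uv vt))//.
by rewrite mulrC -ler_pdivlMr// mulrAC HF.
Qed.

Lemma ito_smallM F f M : 0 < M -> (forall u, s <= u <= t -> `|f u| <= M) ->
  ito_small F -> ito_small (fun u v => f u * F u v).
Proof.
move=> M0 fM nF; apply: (ito_small_dominated M0 nF) => u v su uv vt.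
by rewrite normrM ler_wpM2r// fM// su (le_trans (ltW uv)).
Qed.

(** A smooth function of time contributes to the gains as if it were linear on
    each cell: the mean value theorem replaces its increment by the derivative at an
    intermediate date, which is uniformly close to the one at the left end. *)
Lemma ito_small_is_derive f df :
  (forall u, s <= u <= t -> is_derive u 1 f (df u)) -> cts_on s t df ->
  ito_small (fun u v => f v - f u - df u * (v - u)).
Proof.
move=> fdf cdf e e0; have [h h0 H] := cts_unif cdf e0.
exists h => // u v su uv vt uvh.
have D y : u <= y <= v -> is_derive y 1 f (df y).
  by move=> /andP[uy yv]; apply: fdf; rewrite (le_trans su uy) (le_trans yv vt).
have [|| c cuv ->] := @MVT_segment R f df u v (ltW uv).
- by move=> y /[!in_itv]/= /andP[uy yv]; apply: D; rewrite !ltW.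
- by apply: derivable_within_continuous => y /[!in_itv]/= /D[].
move: cuv; rewrite in_itv/= => /andP[uc cv].
rewrite -mulrBl normrM (@ger0_norm _ (v - u)) ?subr_ge0 ?(ltW uv)//.
rewrite (@le_trans _ _ (e * (v - u)))//.
  rewrite ler_wpM2r ?subr_ge0 ?(ltW uv)// ltW// H//.
    by rewrite su (le_trans uc)// (le_trans cv).
  by rewrite ger0_norm ?subr_ge0//; lra.
by rewrite ler_pM2l// lerDl sqr_ge0.
Qed.

End ito_small_terms.

Section psum_convergence.
Context {R : realType}.
Variables (s t : R) (x : R -> R) (l : nat -> seq R).
Hypothesis lP : forall n, itv_partition s t (l n).
Hypothesis lfine : forall h, 0 < h -> \forall n \near \oo, mesh_lt h s (l n).

Lemma psum_diff n : partition_sum (fun u v => v - u) s (l n) = t - s.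
Proof. exact: (psum_telescope id). Qed.

(** An error which is small compared with a quantity of bounded sum has a vanishing
    sum; this is all that is needed of the terms neglected in the Ito formula. *)
Lemma ito_small_psum_cvg0 Q F :
  (\forall n \near \oo, partition_sum (fun u v => (x v - x u) ^+ 2) s (l n) <= Q) ->
  ito_small s t x F -> partition_sum F s (l n) @[n --> \oo] --> 0.
Proof.
move=> HQ nF; apply/cvgrPdist_le => e e0.
pose M := `|t - s| + `|Q| + 1.
have M0 : 0 < M by rewrite ltr_wpDl// addr_ge0.
have [h h0 H] := nF (e / M) (divr_gt0 e0 M0).
near=> n; rewrite sub0r normrN.
apply: (le_trans (ler_norm_psum _ _ _)).
apply: (@le_trans _ _ (partition_sum (fun u v => (e / M) * ito_size x u v) s (l n))).
  apply: (psum_le_mesh (lP n) (h := h)); last exact: H.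
  by near: n; exact: lfine.
rewrite psumZ psumD psum_diff mulrAC ler_pdivrMr// ler_pM2l//.
rewrite /M (@le_trans _ _ (`|t - s| + `|Q|)) ?lerDl//.
rewrite lerD ?ler_norm// (le_trans _ (ler_norm Q))//.
by near: n.
Unshelve. all: by end_near. Qed.

(** The countable family of weights for which the convergence of the weighted
    quadratic variations is obtained almost surely; step functions over the cells of
    mesh 1 / (N + 1) are uniformly dense among the continuous weights. *)
Definition step_weight (N i : nat) (u : R) : R := (Num.truncn (u * N.+1%:R) == i)%:R.

Definition sq_increment_dev (u v : R) : R := (x v - x u) ^+ 2 - (v - u).

Hypothesis s0 : 0 <= s.
Hypothesis qv : forall N i : nat,
  partition_sum (fun u v => step_weight N i u * sq_increment_dev u v) s (l n) @[n --> \oo] --> (0 : R).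

Let node N i : R := Num.max s (i%:R / N.+1%:R).

Let step g N (u : R) : R :=
  \sum_(i < (Num.truncn (t * N.+1%:R)).+1) g (node N i) * step_weight N i u.

Let stepE g N u : s <= u <= t -> step g N u = g (node N (Num.truncn (u * N.+1%:R))).
Proof.
move=> /andP[su ut].
have u0 := le_trans s0 su.
have ilt : (Num.truncn (u * N.+1%:R) < (Num.truncn (t * N.+1%:R)).+1)%N.
  by rewrite ltnS; apply: le_truncn; rewrite ler_wpM2r.
rewrite /step (bigD1 (Ordinal ilt)) //= /step_weight eqxx mulr1 big1 ?addr0// => i.
by move=> /eqP ine; case: eqP; rewrite ?mulr0// => ti; case: ine; apply/val_inj.
Qed.

Let node_dist N u : s <= u <= t ->
  s <= node N (Num.truncn (u * N.+1%:R)) <= u /\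
  u - node N (Num.truncn (u * N.+1%:R)) < N.+1%:R^-1.
Proof.
move=> /andP[su ut].
have u0 := le_trans s0 su.
have N0 : (0 : R) < N.+1%:R by [].
have /truncn_itv /andP[a b] : 0 <= u * N.+1%:R by rewrite mulr_ge0.
rewrite /node le_max lexx/= ge_max su /= ler_pdivrMr// a; split=> //.
rewrite ltrBlDr -ltrBlDl lt_max; apply/orP; right.
rewrite ltrBlDl -(ltr_pM2r N0) mulrDl mulVf// mulfVK// addrC natr1.
exact: b.
Qed.

Let step_qdev_cvg0 g N :
  partition_sum (fun u v => step g N u * sq_increment_dev u v) s (l n) @[n --> \oo] --> 0.
Proof.
pose m := (Num.truncn (t * N.+1%:R)).+1.
rewrite [X in X @ _ --> _](_ : _ = (fun n => \sum_(i < m) g (node N i) *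
    partition_sum (fun u v => step_weight N i u * sq_increment_dev u v) s (l n))); last first.
  apply/funext => n; rewrite /partition_sum /step.
  under eq_bigr do rewrite mulr_suml.
  rewrite exchange_big /=; apply: eq_bigr => i _; rewrite mulr_sumr.
  by apply: eq_bigr => k _; rewrite mulrA.
rewrite [X in _ --> X](_ : _ = \sum_(i < m) g (node N i) * 0); last first.
  by rewrite big1// => i _; rewrite mulr0.
apply: cvg_big => [|i _]; first exact: add_continuous.
by apply: cvgM; [exact: cvg_cst|exact: qv].
Qed.

Lemma qv_cvg : partition_sum (fun u v => (x v - x u) ^+ 2) s (l n) @[n --> \oo] --> t - s.
Proof.
have /cvgrPdist_lt H := @step_qdev_cvg0 (fun=> 1) 0.
apply/cvgrPdist_lt => e /H; apply: filterS => n; rewrite !sub0r !normrN.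
rewrite (_ : partition_sum _ _ _ = partition_sum (fun u v => (x v - x u) ^+ 2) s (l n) - (t - s)).
  by rewrite distrC.
rewrite -(psum_diff n) -psumB; apply: (eq_psum (lP n)) => u v su uv vt.
by rewrite stepE ?mul1r// su (le_trans (ltW uv)).
Qed.

Lemma qv_bounded :
  \forall n \near \oo, partition_sum (fun u v => (x v - x u) ^+ 2) s (l n) <= t - s + 1.
Proof.
have /cvgrPdist_lt/(_ 1 ltr01) := qv_cvg; apply: filterS => n.
by rewrite distrC => /(le_lt_trans (ler_norm _)); lra.
Qed.

(** The weight g may depend on the path. It is replaced by a step function, for
    which the hypothesis on the weights step_weight applies cell by cell; the error is
    the modulus of continuity of g times the total quadratic variation, which is
    bounded. *)
Lemma weighted_qv_cvg0 g : cts_on s t g ->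
  partition_sum (fun u v => g u * sq_increment_dev u v) s (l n) @[n --> \oo] --> 0.
Proof.
move=> cg; apply/cvgrPdist_le => e e0.
pose M := 2 * `|t - s| + 1.
have M0 : 0 < M by rewrite ltr_wpDl// mulr_ge0.
have [h h0 H] := cts_unif cg (divr_gt0 (divr_gt0 e0 (ltr0n R 2)) M0).
have [N /= Nh] : exists N : nat, N.+1%:R^-1 < h.
  exists (Num.truncn h^-1); rewrite invf_plt ?posrE//; exact: truncnS_gt.
have /cvgrPdist_le/(_ (e / 2)) := @step_qdev_cvg0 g N.
rewrite divr_gt0// => /(_ isT) Hs.
near=> n.
rewrite sub0r normrN.
rewrite (_ : partition_sum _ _ _ = partition_sum (fun u v => step g N u * sq_increment_dev u v) s (l n) +
    partition_sum (fun u v => (g u - step g N u) * sq_increment_dev u v) s (l n)); last first.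
  by rewrite -psumD; apply: (eq_psum (lP n)) => u v _ _ _; ring.
rewrite (le_trans (ler_normD _ _))// (splitr e) lerD//.
  by rewrite -normrN -sub0r; near: n.
rewrite (le_trans (ler_norm_psum _ _ _))//.
rewrite (@le_trans _ _ (partition_sum (fun u v => (e / 2 / M) * ito_size x u v) s (l n)))//.
  apply: (psum_le (lP n)).
  move=> u v su uv vt; rewrite normrM.
  have ust : s <= u <= t by rewrite su (le_trans (ltW uv)).
  have [/andP[sn nu] un] := @node_dist N u ust.
  rewrite stepE// ler_pM//.
    apply: ltW; apply: H; first by rewrite sn (le_trans nu)//; case/andP: ust.
    by rewrite ger0_norm ?subr_ge0//; exact: lt_trans Nh.
  rewrite /sq_increment_dev /ito_size ler_norml; have := sqr_ge0 (x v - x u).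
  by move=> ?; apply/andP; split; lra.
rewrite psumZ psumD psum_diff mulrAC ler_pdivrMr// ler_pM2l ?divr_gt0//.
have qvn : partition_sum (fun u v => (x v - x u) ^+ 2) s (l n) <= t - s + 1.
  by near: n; exact: qv_bounded.
have := ler_norm (t - s); rewrite /M; lra.
Unshelve. all: by end_near. Qed.

End psum_convergence.

(** * Second-order expansion of the option price along a path *)

Section ito_expansion.
Context {R : realType}.
Variables (T : R) (C : R -> R -> R).
Hypothesis hC : ito_smooth T C.
Implicit Types (s t u v z : R).

Let Cz := partial_z C.
Let Ct := partial_t C.
Let Czz := partial_z (partial_z C).

(** C is continuous in z at the date u, and it varies slowly in time because its
    time derivative is bounded near (z, u). *)
Lemma ito_smooth_continuous z u : 0 < `|z| -> 0 < u < T ->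
  {for (z, u), continuous (fun p : R * R => C p.1 p.2)}.
Proof.
move=> z0 uT; have [[_ dz _] [cCt _ _]] := hC z0 uT.
apply/cvgrPdist_lt => e e0.
have cz : {for z, continuous (fun y => C y u)}.
  exact: derivable1_continuous dz.
move: cz => /cvgrPdist_lt/(_ (e / 2)); rewrite divr_gt0// => /(_ isT).
move=> /nbhs_ballP[d1 /= d10 H1].
move: cCt => /cvgrPdist_lt/(_ 1 ltr01)/nbhs_ballP[d2 /= d20 H2].
pose M := `|Ct z u| + 1.
have M0 : 0 < M by rewrite ltr_wpDl.
have /andP[u0 uT'] := uT.
pose d := Num.min (Num.min d1 d2) (Num.min (Num.min `|z| u) (Num.min (T - u) (e / 2 / M))).
have d0 : 0 < d.
  by rewrite !lt_min d10 d20 z0 u0 subr_gt0 uT' !divr_gt0.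
exists (ball z d, ball u d) => /=; first by split; exact: nbhsx_ballx.
move=> [y v] [/=]; rewrite /ball /= !lt_min => /andP[/andP[y1 y2] /andP[/andP[yz _] _]].
move=> /andP[/andP[_ v2] /andP[/andP[_ vu] /andP[vT ve]]].
have y0 : 0 < `|y|.
  by rewrite normr_gt0; apply/eqP => y0; move: yz; rewrite y0 subr0 ltxx.
have [|c cu Cc] := @mvt_dist R (C y) (fun v => Ct y v) u v.
  move=> w wu.
  have wT : 0 < w < T.
    move: wu; rewrite (distrC v) => wu.
    move: (le_lt_trans wu vu) (le_lt_trans wu vT).
    by rewrite !ltr_norml => /andP[? ?] /andP[? ?]; apply/andP; split; lra.
  by have [[? _ _] _] := hC y0 wT; rewrite /Ct /partial_t derive1E; exact: derivableP.
have Ctc : `|Ct y c| <= M.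
  have : `|Ct z u - Ct y c| < 1.
    by apply: (H2 (y, c)); split => //=; rewrite /ball /= distrC (le_lt_trans cu)// distrC.
  by move=> H; rewrite /M -[Ct y c](subKr (Ct z u)) (le_trans (ler_normB _ _))// lerD2l ltW.
rewrite (_ : C z u - C y v = (C z u - C y u) - (C y v - C y u)); last by ring.
rewrite (le_lt_trans (ler_normB _ _))// (splitr e) ltrD//.
  exact: H1.
rewrite Cc normrM (le_lt_trans (ler_wpM2r _ Ctc))// mulrC -ltr_pdivlMr//.
by rewrite distrC.
Qed.

(** The analytic heart of the Ito formula, path by path. The increment of C is
    split at (z v, u): the time part is handled by the mean value theorem, the space
    part by the second-order Taylor estimate. The compact set on which the
    derivatives are uniformly continuous is {rho <= |y| <= Mz} x [s, t]; the weight f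
    vanishes when the path leaves it, which is what allows C to be irregular at 0. *)
Lemma ito_small_expansion s t (x z f : R -> R) (K rho : R) :
  0 < s -> t < T -> 0 < rho -> 0 < K -> cts_on s t z ->
  (exists2 M, 0 < M & forall u, s <= u <= t -> `|f u| <= M) ->
  (forall u, s <= u <= t -> f u != 0 -> rho <= `|z u|) ->
  (forall u v, s <= u -> u < v -> v <= t -> (z v - z u) ^+ 2 <= K * ito_size x u v) ->
  ito_small s t x (fun u v => f u *
    (C (z v) v - C (z u) u - Cz (z u) u * (z v - z u) - Ct (z u) u * (v - u)
     - 1 / 2 * Czz (z u) u * (z v - z u) ^+ 2)).
Proof.
move=> s0 tT rho0 K0 cz [M M0 fM] frho zK e e0.
have [Mz Mz0 zM] := cts_bounded cz.
pose A : set R := `[- Mz, - rho] `|` `[rho, Mz].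
have cA : compact (A `*` `[s, t]).
  by apply: compact_setX; [apply: compactU; exact: segment_compact|exact: segment_compact].
have AT p : (A `*` `[s, t]) p -> 0 < `|p.1| /\ 0 < p.2 < T.
  case: p => y u [/= Ay]; rewrite in_itv/= => /andP[su ut].
  rewrite (lt_le_trans s0 su) (le_lt_trans ut tT) normr_gt0; split=> //.
  by case: Ay; rewrite /= in_itv/= => /andP[a b]; [rewrite lt_eqF|rewrite gt_eqF];
    rewrite //; lra.
(* (v - u) + (z v - z u)^2 <= (1 + K) (ito_size x u v), and |f| <= M. *)
pose e' := e / (M * (1 + K)).
have K10 : 0 < 1 + K by rewrite ltr_wpDl.
have e'0 : 0 < e' by rewrite divr_gt0// mulr_gt0.
have [p Ap|h1 h10 H1] := compact_unif_continuous (f := fun p : R * R => Ct p.1 p.2) cA _ e'0.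
  have [p1 p2] := AT _ Ap; case: p p1 p2 {Ap} => y u /= p1 p2.
  by have [_ [c _ _]] := hC p1 p2; exact: c.
have [p Ap|h2 h20 H2] := compact_unif_continuous (f := fun p : R * R => Czz p.1 p.2) cA _ e'0.
  have [p1 p2] := AT _ Ap; case: p p1 p2 {Ap} => y u /= p1 p2.
  by have [_ [_ _ c]] := hC p1 p2; exact: c.
(* The bound by rho keeps 0 out of the segment from z u to z v. *)
pose h := Num.min (Num.min h1 h2) rho.
have h0 : 0 < h by rewrite !lt_min h10 h20 rho0.
have [h3 h30 H3] := cts_unif cz h0.
exists (Num.min h3 h); first by rewrite lt_min h30 h0.
move=> u v su uv vt; rewrite lt_min => /andP[uv3]; rewrite !lt_min => /andP[/andP[uv1 uv2] _].
have ust : s <= u <= t by rewrite su (le_trans (ltW uv)).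
have [->|fu0] := eqVneq (f u) 0.
  by rewrite mul0r normr0 mulr_ge0 ?(ltW e0)//; exact: ito_size_ge0.
have zr := frho u ust fu0.
have Au : (A `*` `[s, t]) (z u, u).
  split => /=; last by rewrite in_itv.
  have := zM u ust; rewrite /A /= !in_itv/=; move: zr.
  have [zu0|zu0] := leP 0 (z u); rewrite ?(ger0_norm zu0) ?(ltr0_norm zu0) => a b.
    by right; rewrite a b.
  by left; apply/andP; split; lra.
have := H3 u v ust; rewrite gtr0_norm ?subr_gt0// => /(_ uv3).
rewrite !lt_min => /andP[/andP[dz1 dz2] dzr].
have near0 y : `|y - z u| <= `|z v - z u| -> 0 < `|y|.
  move=> yz; rewrite normr_gt0; apply/eqP => y0; move: yz; rewrite y0 sub0r normrN leNgt.
  by rewrite (lt_le_trans dzr zr).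
have inT w : u <= w -> w <= v -> 0 < w < T.
  by move=> uw wv; rewrite (lt_le_trans s0 (le_trans su uw)) (le_lt_trans (le_trans wv vt)).
have [||c cuv Cc] := @MVT_segment R (C (z v)) (fun w => Ct (z v) w) u v (ltW uv).
- move=> w; rewrite in_itv/= => /andP[uw wv]; rewrite /Ct /partial_t derive1E.
  by have [[? _ _] _] := hC (near0 (z v) (lexx _)) (inT w (ltW uw) (ltW wv)); exact: derivableP.
- apply: derivable_within_continuous => w; rewrite in_itv/= => /andP[uw wv].
  by have [[? _ _] _] := hC (near0 (z v) (lexx _)) (inT w uw wv).
move: cuv; rewrite in_itv/= => /andP[uc cv].
have tpart : `|C (z v) v - C (z v) u - Ct (z u) u * (v - u)| <= e' * (v - u).
  rewrite Cc -mulrBl normrM (@ger0_norm _ (v - u)) ?subr_ge0 ?(ltW uv)//.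
  rewrite ler_wpM2r ?subr_ge0 ?(ltW uv)// ltW//.
  apply: (H1 (z u, u) Au (z v, c)); split; rewrite /ball /= distrC//.
  by rewrite ger0_norm ?subr_ge0//; lra.
have zpart : `|C (z v) u - C (z u) u - Cz (z u) u * (z v - z u)
     - 1 / 2 * Czz (z u) u * (z v - z u) ^+ 2| <= e' * (z v - z u) ^+ 2.
  apply: (@taylor2_dist R (fun y => C y u) (z u) (z v) e') => y yz.
  have [[_ d1 d2] _] := hC (near0 y yz) (inT u (lexx _) (ltW uv)).
  split; [exact: d1|exact: d2|].
  apply: ltW; apply: (H2 (z u, u) Au (y, u)); split; rewrite /ball /=.
    by rewrite distrC (le_lt_trans yz).
  by rewrite subrr normr0.
rewrite normrM.
rewrite (_ : C (z v) v - _ - _ - _ - _ = (C (z v) v - C (z v) u - Ct (z u) u * (v - u)) +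
    (C (z v) u - C (z u) u - Cz (z u) u * (z v - z u)
     - 1 / 2 * Czz (z u) u * (z v - z u) ^+ 2)); last by ring.
apply: (@le_trans _ _ (M * (e' * (v - u) + e' * (K * ito_size x u v)))).
  rewrite ler_pM// ?fM// (le_trans (ler_normD _ _))// lerD//.
  by rewrite (le_trans zpart)// ler_pM2l// zK.
rewrite -mulrDr.
have -> : e * ito_size x u v = e' * (M * ((1 + K) * ito_size x u v)).
  by rewrite /e'; field; rewrite !gt_eqF.
rewrite mulrCA ler_pM2l// ler_pM2l// mulrDl mul1r lerD2r.
by rewrite /ito_size lerDl sqr_ge0.
Qed.

End ito_expansion.

(** * Cutting off the singularity of the option price at zero *)

Section cutoff_at_zero.
Context {R : realType}.
Variables (T rho : R).
Hypothesis rho0 : 0 < rho.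
Implicit Types (H : R -> R -> R).

(** The hedge is switched off near 0, where the option price need not be regular.
    A continuous cutoff is enough, since Ito sums only sample the position. *)
Definition cutoff (z : R) : R := Num.max 0 (`|z| - rho).

(** The regularity of the partial derivatives of the option price. *)
Definition cts_off0 H : Prop := forall z u, 0 < `|z| -> 0 < u < T ->
  {for (z, u), continuous (fun p : R * R => H p.1 p.2)}.

Lemma cutoff_ge0 z : 0 <= cutoff z.
Proof. by rewrite /cutoff le_max lexx. Qed.

Lemma cutoff_neq0 z : cutoff z != 0 -> rho <= `|z|.
Proof.
rewrite /cutoff; apply: contraR; rewrite -ltNge => zr.
by apply/eqP/max_idPl; lra.
Qed.

Lemma continuous_cutoff : continuous cutoff.
Proof.
move=> z; apply: (@continuous_max R R (fun=> 0) (fun z => `|z| - rho)).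
  exact: cvg_cst.
by apply: cvgB; [exact: norm_continuous|exact: cvg_cst].
Qed.

Lemma cutoff_continuous H : cts_off0 H -> forall z u, 0 < u < T ->
  {for (z, u), continuous (fun p : R * R => cutoff p.1 * H p.1 p.2)}.
Proof.
move=> cH z u uT; have [z0|z0] := ltP 0 `|z|.
  apply: cvgM; last exact: cH.
  apply: (@cvg_comp _ _ _ fst cutoff _ (nbhs z)); first exact: cvg_fst.
  exact: continuous_cutoff.
have -> : z = 0 by apply/eqP; rewrite -normr_le0.
apply: (@near_cst_continuous _ _ 0).
exists (ball (0:R) rho, setT) => /=; first by split; [exact: nbhsx_ballx|exact: filterT].
move=> [y v] /= [+ _]; rewrite /ball /= sub0r normrN => yr.
by rewrite /cutoff max_l ?mul0r// subr_le0 ltW.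
Qed.

Lemma cutoff_section_continuous H : cts_off0 H -> forall u, 0 < u < T ->
  continuous (fun z => cutoff z * H z u).
Proof.
move=> cH u uT z.
apply: (@continuous2_cvg _ _ _ _ _ _ id (fun=> u) (fun y v => cutoff y * H y v)); last 2 first.
- exact: cvg_id.
- exact: cvg_cst.
- exact: cutoff_continuous.
Qed.

Lemma cutoff_path_continuous H s t (z : R -> R) : cts_off0 H ->
  0 < s -> t < T -> cts_on s t z -> cts_on s t (fun u => cutoff (z u) * H (z u) u).
Proof.
move=> cH s0 tT cz u ust; have /andP[su ut] := ust.
have uT : 0 < u < T by rewrite (lt_le_trans s0 su) (le_lt_trans ut tT).
apply: (@continuous2_cvg _ _ _ _ _ _ z id (fun y v => cutoff y * H y v)); last 2 first.
- exact: cz.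
- exact: cvg_id.
- exact: cutoff_continuous.
Qed.

Lemma cts_off0D H1 H2 : cts_off0 H1 -> cts_off0 H2 ->
  cts_off0 (fun z u => H1 z u + H2 z u).
Proof. by move=> c1 c2 z u z0 uT; apply: cvgD; [exact: c1|exact: c2]. Qed.

Lemma cts_off0M H1 H2 : cts_off0 H1 -> cts_off0 H2 ->
  cts_off0 (fun z u => H1 z u * H2 z u).
Proof. by move=> c1 c2 z u z0 uT; apply: cvgM; [exact: c1|exact: c2]. Qed.

Lemma cts_off0N H : cts_off0 H -> cts_off0 (fun z u => - H z u).
Proof. by move=> c z u z0 uT; apply: cvgN; exact: c. Qed.

Lemma cts_off0_cst c : cts_off0 (fun _ _ => c).
Proof. by move=> z u z0 uT; exact: cvg_cst. Qed.

Lemma cts_off0_z : cts_off0 (fun z _ => z).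
Proof. by move=> z u z0 uT; exact: cvg_fst. Qed.

Lemma cts_off0_time (g : R -> R) : (forall u, 0 < u -> {for u, continuous g}) ->
  cts_off0 (fun _ u => g u).
Proof.
move=> cg z u z0 /andP[u0 _].
by apply: (@cvg_comp _ _ _ snd g _ (nbhs u)); [exact: cvg_snd|exact: cg].
Qed.

End cutoff_at_zero.

(** * Quadratic variation of a path with a smooth scale *)

Section scaled_path.
Context {R : realType}.
Variables (s t : R) (x b db : R -> R).
Hypothesis cx : cts_on s t x.
Hypothesis bE : forall u, s <= u <= t -> is_derive u 1 b (db u).
Hypothesis cdb : cts_on s t db.

Let z u := b u * x u.

Lemma is_derive_cts : cts_on s t b.
Proof. by move=> u ust; exact: is_derive1_continuous (bE ust). Qed.

Lemma scaled_path_cts : cts_on s t z.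
Proof. by move=> u ust; apply: cvgM; [exact: is_derive_cts|exact: cx]. Qed.

Let lipschitz : exists2 L, 0 < L & forall u v, s <= u -> u < v -> v <= t ->
  `|b v - b u| <= L * (v - u).
Proof.
have [L L0 HL] := cts_bounded cdb; exists L => // u v su uv vt.
have inst y : u <= y -> y <= v -> s <= y <= t.
  by move=> uy yv; rewrite (le_trans su uy) (le_trans yv vt).
have [||c] := @MVT_segment R b db u v (ltW uv).
- by move=> y; rewrite in_itv/= => /andP[uy yv]; apply/bE/inst; exact: ltW.
- apply: cts_within => y /andP[uy yv]; exact: is_derive_cts (inst _ uy yv).
rewrite in_itv/= => /andP[uc cv] ->.
by rewrite normrM (@gtr0_norm _ (v - u)) ?subr_gt0// ler_pM2r ?subr_gt0// HL// inst.
Qed.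

(** The scale b has increments of order v - u, so that it does not contribute to
    the quadratic variation of the product. *)
Lemma ito_small_scaled_sq :
  ito_small s t x (fun u v => (z v - z u) ^+ 2 - b u ^+ 2 * (x v - x u) ^+ 2).
Proof.
have [L L0 HL] := lipschitz.
have [Mx Mx0 xM] := cts_bounded cx; have [Mb Mb0 bM] := cts_bounded is_derive_cts.
move=> e e0.
pose K := Mx * L * (2 * Mb + Mx * L).
have K0 : 0 < K by rewrite !mulr_gt0// addr_gt0 ?mulr_gt0.
have [h1 h10 H1] := cts_unif cx (divr_gt0 e0 K0).
exists (Num.min h1 (e / K)); first by rewrite lt_min h10 divr_gt0.
move=> u v su uv vt; rewrite lt_min => /andP[uv1 uvK].
have ust : s <= u <= t by rewrite su (le_trans (ltW uv)).
have vst : s <= v <= t by rewrite vt (le_trans su (ltW uv)).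
have vu0 : 0 < v - u by rewrite subr_gt0.
have dx : `|x v - x u| <= e / K by apply/ltW/H1; rewrite // gtr0_norm.
have xb : `|x v * (b v - b u)| <= Mx * L * (v - u).
  by rewrite normrM -mulrA ler_pM ?xM// HL.
rewrite (_ : _ - _ = x v * (b v - b u) * (2 * b u * (x v - x u) + x v * (b v - b u))); last first.
  by rewrite /z; ring.
rewrite normrM.
apply: (@le_trans _ _ (Mx * L * (v - u) * (2 * Mb * (e / K) + Mx * L * (e / K)))).
  rewrite ler_pM// (le_trans (ler_normD _ _))// lerD//.
    by rewrite 2!normrM ler_pM ?mulr_ge0// gtr0_norm// ler_pM2l// bM.
  by rewrite (le_trans xb)// ler_pM2l ?mulr_gt0// ltW.
rewrite (_ : _ * _ = e * (v - u)).
  by rewrite ler_pM2l// /ito_size lerDl sqr_ge0.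
rewrite -mulrDl /K; field.
by rewrite !gt_eqF// addr_gt0 ?mulr_gt0.
Qed.

Lemma scaled_sq_le : exists2 K, 0 < K & forall u v, s <= u -> u < v -> v <= t ->
  (z v - z u) ^+ 2 <= K * ito_size x u v.
Proof.
have [L L0 HL] := lipschitz.
have [Mx Mx0 xM] := cts_bounded cx; have [Mb Mb0 bM] := cts_bounded is_derive_cts.
exists (2 * Mb ^+ 2 + 2 * (Mx * L) ^+ 2 * (`|t - s| + 1)) => [|u v su uv vt].
  by rewrite addr_gt0 ?mulr_gt0 ?exprn_gt0 ?mulr_gt0// ltr_wpDl.
have ust : s <= u <= t by rewrite su (le_trans (ltW uv)).
have vst : s <= v <= t by rewrite vt (le_trans su (ltW uv)).
have vu0 : 0 < v - u by rewrite subr_gt0.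
pose p := b u * (x v - x u); pose q := x v * (b v - b u).
have -> : z v - z u = p + q by rewrite /z /p /q; ring.
have pq : (p + q) ^+ 2 <= 2 * p ^+ 2 + 2 * q ^+ 2 by have := sqr_ge0 (p - q); nra.
have pM : p ^+ 2 <= Mb ^+ 2 * (x v - x u) ^+ 2.
  rewrite /p exprMn ler_wpM2r ?sqr_ge0// -[b u ^+ 2]ger0_norm ?sqr_ge0// normrX.
  by rewrite lerXn2r ?nnegrE ?(ltW Mb0)// bM.
have qM : q ^+ 2 <= (Mx * L) ^+ 2 * ((`|t - s| + 1) * (v - u)).
  rewrite -[q ^+ 2]ger0_norm ?sqr_ge0// normrX.
  have qx : `|q| <= Mx * L * (v - u) by rewrite /q normrM -mulrA ler_pM ?xM// HL.
  apply: (@le_trans _ _ ((Mx * L * (v - u)) ^+ 2)).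
    by rewrite lerXn2r ?nnegrE// !mulr_ge0// ltW.
  rewrite exprMn ler_wpM2l ?sqr_ge0// expr2 ler_wpM2r ?(ltW vu0)//.
  by have := ler_norm (t - s); lra.
have A0 : 0 <= Mb ^+ 2 by exact: sqr_ge0.
have B0 : 0 <= (Mx * L) ^+ 2 * (`|t - s| + 1) by rewrite mulr_ge0 ?sqr_ge0 ?addr_ge0.
have X0 : 0 <= (x v - x u) ^+ 2 by exact: sqr_ge0.
rewrite /ito_size; set A := Mb ^+ 2 in A0 pM *; set X := (x v - x u) ^+ 2 in pM X0 *.
rewrite mulrA in qM; rewrite -(mulrA 2).
set BB := (Mx * L) ^+ 2 * _ in B0 qM *.
nra.
Qed.

End scaled_path.

(** * The volatility coefficient *)

Section B_coefficient.
Context {R : realType}.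
Variables (mu sigma beta : R).

Definition dB_coef (u : R) : R :=
  drift_q mu sigma * (- (beta - 1) * u `^ (- (beta - 1) - 1)) +
  sigma * (- beta * u `^ (- beta - 1)).

Lemma B_coefE u :
  B_coef mu sigma beta u = drift_q mu sigma * u `^ (- (beta - 1)) + sigma * u `^ (- beta).
Proof. by rewrite /B_coef !powRN. Qed.

Lemma is_derive_B_coef (u : R) : 0 < u -> is_derive u 1 (B_coef mu sigma beta) (dB_coef u).
Proof.
move=> u0.
have -> : B_coef mu sigma beta =
    (fun u => drift_q mu sigma * u `^ (- (beta - 1)) + sigma * u `^ (- beta)).
  by apply/funext => v; exact: B_coefE.
have d1 := is_derive1_powR (- (beta - 1)) u0.
have d2 := is_derive1_powR (- beta) u0.
by apply: is_derive_eq; rewrite /dB_coef /GRing.scale /=; ring.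
Qed.

Lemma powR_continuous a (u : R) : 0 < u -> {for u, continuous (fun v => v `^ a)}.
Proof. by move=> u0; exact: is_derive1_continuous (is_derive1_powR a u0). Qed.

Lemma dB_coef_continuous (u : R) : 0 < u -> {for u, continuous dB_coef}.
Proof.
move=> u0; apply: cvgD; apply: cvgM; try exact: cvg_cst;
  (apply: cvgM; [exact: cvg_cst|exact: powR_continuous]).
Qed.

Lemma Z_processE (d : measure_display) (Omega : measurableType d)
    (P : probability Omega R) (W : R -> {RV P >-> R}) u w :
  Z_process W mu sigma beta u w = B_coef mu sigma beta u * W u w.
Proof. by rewrite /Z_process /B_coef; ring. Qed.

End B_coefficient.

(** * Gains of the hedged portfolio along a path *)

Section pathwise_hedge.
Context {R : realType}.
Variables (T r rho : R) (C : R -> R -> R) (b db : R -> R).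
Hypothesis hC : ito_smooth T C.
Hypothesis rho0 : 0 < rho.
Hypothesis bE : forall u : R, 0 < u -> is_derive u 1 b (db u).
Hypothesis cdb : forall u : R, 0 < u -> {for u, continuous db}.

Let Cz := partial_z C.
Let Ct := partial_t C.
Let Czz := partial_z (partial_z C).
Let chi := cutoff rho.

(** b stands for the volatility coefficient. *)
Definition pde_lhs (z u : R) : R :=
  Ct z u + r * z * Cz z u + 1 / 2 * b u ^+ 2 * Czz z u - r * C z u.

Lemma cts_off0_C : cts_off0 T C.
Proof. by move=> z u z0 uT; exact: (ito_smooth_continuous hC). Qed.
Lemma cts_off0_Cz : cts_off0 T Cz.
Proof. by move=> z u z0 uT; have [_ [_ c _]] := hC z0 uT; exact: c. Qed.
Lemma cts_off0_Ct : cts_off0 T Ct.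
Proof. by move=> z u z0 uT; have [_ [c _ _]] := hC z0 uT; exact: c. Qed.
Lemma cts_off0_Czz : cts_off0 T Czz.
Proof. by move=> z u z0 uT; have [_ [_ _ c]] := hC z0 uT; exact: c. Qed.

Let b_continuous (u : R) : 0 < u -> {for u, continuous b}.
Proof. by move=> u0; exact: is_derive1_continuous (bE u0). Qed.

Lemma cts_off0_pde_lhs : cts_off0 T pde_lhs.
Proof.
apply: (@cts_off0D _ _ (fun z u => Ct z u + r * z * Cz z u + 1 / 2 * b u ^+ 2 * Czz z u)
  (fun z u => - (r * C z u))).
  apply: (@cts_off0D _ _ (fun z u => Ct z u + r * z * Cz z u)
    (fun z u => 1 / 2 * b u ^+ 2 * Czz z u)).
    apply: (@cts_off0D _ _ Ct); first exact: cts_off0_Ct.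
    apply: (@cts_off0M _ _ (fun z _ => r * z)); last exact: cts_off0_Cz.
    by apply: (@cts_off0M _ _ (fun _ _ => r)); [exact: cts_off0_cst|exact: cts_off0_z].
  apply: (@cts_off0M _ _ (fun _ u => 1 / 2 * b u ^+ 2)); last exact: cts_off0_Czz.
  apply: (@cts_off0_time _ _ (fun u => 1 / 2 * b u ^+ 2)) => u u0.
  apply: cvgM; first exact: cvg_cst.
  by apply: (@continuous_comp _ _ _ b (fun y => y ^+ 2)); [exact: b_continuous|exact: exprn_continuous].
apply: (@cts_off0N _ _ (fun z u => r * C z u)).
by apply: (@cts_off0M _ _ (fun _ _ => r)); [exact: cts_off0_cst|exact: cts_off0_C].
Qed.

(** The number of options held is itself proportional to the left-hand side of the
    equation. The excess return rate of the hedged position is then proportional to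
    its square, and the absence of arbitrage forces this square to vanish without
    any discussion of signs. *)
Definition hedge_option (z u : R) : R := chi z * pde_lhs z u.
(** Minus the number of options times the derivative of the price: the terms in
    dW cancel. *)
Definition hedge_stock (z u : R) : R := chi z * (- (pde_lhs z u * Cz z u)).
(** The bank account absorbs whatever remains of the current wealth y. *)
Definition hedge_bank (y z u : R) : R :=
  (y - chi z * (pde_lhs z u * (C z u - Cz z u * z))) / expR (r * u).
(** The drift left once the dW terms have cancelled: the riskless return, plus the
    number of options times the left-hand side of the equation. *)
Definition wealth_rate (y z u : R) : R := r * y + chi z * (pde_lhs z u * pde_lhs z u).

Lemma hedge_value (y z u : R) :
  hedge_option z u * C z u + hedge_stock z u * z + hedge_bank y z u * expR (r * u) = y.
Proof.
rewrite /hedge_bank divfK; last by rewrite gt_eqF// expR_gt0.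
by rewrite /hedge_option /hedge_stock; ring.
Qed.

Variables (s t : R) (x V : R -> R) (l : nat -> seq R).
Hypotheses (s0 : 0 < s) (tT : t < T).
Hypothesis cx : cts_on s t x.
Hypothesis lP : forall n, itv_partition s t (l n).
Hypothesis lfine : forall h, 0 < h -> \forall n \near \oo, mesh_lt h s (l n).
Hypothesis qv : forall N i : nat,
  partition_sum (fun u v => step_weight N i u * sq_increment_dev x u v) s (l n) @[n --> \oo] --> (0 : R).

Let z u := b u * x u.

Hypothesis VE : forall u : R, s <= u <= t -> is_derive u 1 V (wealth_rate (V u) (z u) u).

Let pos u : s <= u <= t -> 0 < u.
Proof. by move=> /andP[su _]; exact: lt_le_trans su. Qed.

Let cz : cts_on s t z.
Proof.
by apply: (scaled_path_cts cx (db := db)) => u /pos; exact: bE.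
Qed.

Let cV : cts_on s t V.
Proof. by move=> u ust; exact: is_derive1_continuous (VE ust). Qed.

Let cchi H : cts_off0 T H -> cts_on s t (fun u => chi (z u) * H (z u) u).
Proof. by move=> cH; exact: (cutoff_path_continuous (T := T)). Qed.

Let c_option : cts_on s t (fun u => hedge_option (z u) u).
Proof. by apply: cchi; exact: cts_off0_pde_lhs. Qed.

Lemma cts_off0_bank : cts_off0 T (fun z u => pde_lhs z u * (C z u - Cz z u * z)).
Proof.
apply: cts_off0M; first exact: cts_off0_pde_lhs.
apply: (@cts_off0D _ _ C (fun z u => - (Cz z u * z))); first exact: cts_off0_C.
apply: (@cts_off0N _ _ (fun z u => Cz z u * z)).
by apply: cts_off0M; [exact: cts_off0_Cz|exact: cts_off0_z].
Qed.

Lemma expR_continuous_lin (u : R) : {for u, continuous (fun v => expR (r * v))}.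
Proof.
apply: (@continuous_comp _ _ _ (fun v => r * v) expR); last exact: continuous_expR.
by apply: cvgM; [exact: cvg_cst|exact: cvg_id].
Qed.

Lemma is_derive_expR_lin (u : R) : is_derive u 1 (fun v => expR (r * v)) (r * expR (r * u)).
Proof. by apply: is_derive_eq; rewrite /GRing.scale /=; ring. Qed.

Let c_bank : cts_on s t (fun u => hedge_bank (V u) (z u) u).
Proof.
move=> u ust; apply: cvgM.
  by apply: cvgB; [exact: cV|exact: (cchi cts_off0_bank)].
by apply: cvgV; [rewrite gt_eqF ?expR_gt0|exact: expR_continuous_lin].
Qed.

Let c_rate : cts_on s t (fun u => wealth_rate (V u) (z u) u).
Proof.
move=> u ust; apply: cvgD.
  by apply: cvgM; [exact: cvg_cst|exact: cV].
exact: (cchi (cts_off0M cts_off0_pde_lhs cts_off0_pde_lhs)).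
Qed.

(** The self-financing condition along one path. On each cell, the gains minus the
    increment of the wealth are, up to small terms, a continuous function of
    time multiplied by the deviation of the squared increment of x from its expected
    value v - u, and the sums of these vanish by the hypothesis on the quadratic
    variation. The drifts cancel by the very definition of the wealth rate. *)
Lemma hedge_gains_cvg :
  partition_sum (fun u v => hedge_option (z u) u * (C (z v) v - C (z u) u) +
     hedge_stock (z u) u * (z v - z u) +
     hedge_bank (V u) (z u) u * (expR (r * v) - expR (r * u))) s (l n) @[n --> \oo]
  --> V t - V s.
Proof.
have bE' u : s <= u <= t -> is_derive u 1 b (db u) by move=> /pos; exact: bE.
have cdb' : cts_on s t db by move=> u /pos; exact: cdb.
pose f u := hedge_option (z u) u.
pose g u := 1 / 2 * (f u * Czz (z u) u).
have cg0 : cts_on s t (fun u => f u * Czz (z u) u).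
  have c := cchi (cts_off0M cts_off0_pde_lhs cts_off0_Czz).
  rewrite (_ : (fun u => f u * _) = (fun u => chi (z u) * (pde_lhs (z u) u * Czz (z u) u))) //.
  by apply/funext => u; rewrite /f /hedge_option mulrA.
have cg : cts_on s t g by move=> u ust; apply: cvgM; [exact: cvg_cst|exact: cg0].
have cgb : cts_on s t (fun u => g u * b u ^+ 2).
  move=> u ust; apply: cvgM; first exact: cg.
  by apply: (@continuous_comp _ _ _ b (fun y => y ^+ 2)); [exact/b_continuous/pos|exact: exprn_continuous].
have [K K0 HK] := scaled_sq_le cx bE' cdb'.
have [Mf Mf0 HMf] := cts_bounded c_option.
have [Mg Mg0 HMg] := cts_bounded cg.
have [Mb Mb0 HMb] := cts_bounded c_bank.
have n1 := @ito_small_expansion R T C hC s t x z f K rho s0 tT rho0 K0 cz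
  (ex_intro2 _ _ Mf Mf0 HMf) _ HK.
have {}n1 := n1 _.
have n2 := ito_smallM Mg0 HMg (ito_small_scaled_sq cx bE' cdb').
have n3 := ito_smallM Mb0 HMb (ito_small_is_derive x (fun u _ => is_derive_expR_lin u) _).
have n4 := ito_small_is_derive x VE c_rate.
(* The four error terms: Taylor remainder of C, variation of the scale b, bank
   account, wealth. *)
pose E u v := f u *
    (C (z v) v - C (z u) u - Cz (z u) u * (z v - z u) - Ct (z u) u * (v - u)
     - 1 / 2 * Czz (z u) u * (z v - z u) ^+ 2)
  + g u * ((b v * x v - b u * x u) ^+ 2 - b u ^+ 2 * (x v - x u) ^+ 2)
  + hedge_bank (V u) (z u) u * (expR (r * v) - expR (r * u) - r * expR (r * u) * (v - u))
  + (-1) * (V v - V u - wealth_rate (V u) (z u) u * (v - u)).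
have nE : ito_small s t x E.
  apply: ito_smallD; first apply: ito_smallD; first apply: ito_smallD.
  - apply: n1 => u ust; rewrite /f /hedge_option mulf_eq0 negb_or => /andP[+ _].
    exact: cutoff_neq0.
  - exact: n2.
  - apply: n3 => u _; apply: cvgM; [exact: cvg_cst|exact: expR_continuous_lin].
  - by apply: (ito_smallM (f := fun=> -1) ltr01) => // u _; rewrite normrN1.
have E0 := ito_small_psum_cvg0 lP lfine (qv_bounded lP (ltW s0) qv) nE.
have Q0 := weighted_qv_cvg0 lP (ltW s0) qv cgb.
rewrite -[X in _ --> X]addr0 -[X in _ --> _ + X]addr0.
rewrite (_ : (fun n => partition_sum _ s (l n)) = (fun n => V t - V s + (partition_sum E s (l n) +
    partition_sum (fun u v => g u * b u ^+ 2 * sq_increment_dev x u v) s (l n)))).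
  by apply: cvgD; [exact: cvg_cst|exact: cvgD E0 Q0].
apply/funext => n; rewrite -(psum_telescope V (lP n)) -!psumD.
apply: (eq_psum (lP n)) => u v su uv vt.
rewrite /E /g /f /sq_increment_dev /wealth_rate /z /hedge_option /hedge_stock /hedge_bank.
have e0 : expR (r * u) != 0 by rewrite gt_eqF ?expR_gt0.
have GE : pde_lhs (b u * x u) u = Ct (b u * x u) u + r * (b u * x u) * Cz (b u * x u) u
  + 1 / 2 * b u ^+ 2 * Czz (b u * x u) u - r * C (b u * x u) u by [].
move: GE; move: (pde_lhs _ _) (Ct _ _) (Cz _ _) (Czz _ _) (chi _) => G ct c1 c2 c0 GE.
(* The two sides differ by a multiple of G minus its own expression. *)
apply/eqP; rewrite -subr_eq0; apply/eqP.
transitivity (- c0 * G * (v - u) * (G - (ct + r * (b u * x u) * c1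
  + 1 / 2 * b u ^+ 2 * c2 - r * C (b u * x u) u))); last by rewrite -GE subrr mulr0.
by field.
Qed.

End pathwise_hedge.

(** * Moments of the Gaussian law *)

Section normal_moments.
Context {R : realType}.
Local Notation leb := (@lebesgue_measure R).

(** The density is a version of the Radon-Nikodym derivative. *)
Lemma ge0_integral_normal_prob (m s : R) (f : R -> \bar R) :
  measurable_fun setT f -> (forall x, 0 <= f x)%E ->
  (\int[normal_prob m s]_x f x = \int[leb]_x (f x * (normal_pdf m s x)%:E))%E.
Proof.
move=> mf f0; have dom := normal_prob_dominates m s.
rewrite -(Radon_Nikodym_SigmaFinite.change_of_variables dom f0 measurableT mf).
apply: ae_eq_integral => //.
- apply: emeasurable_funM => //; apply: measurable_int.
  exact: Radon_Nikodym_SigmaFinite.f_integrable.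
- by apply: emeasurable_funM => //; apply/measurable_EFinP; exact: measurable_normal_pdf.
- apply: ae_eqe_mul2l; apply: integral_ae_eq => //.
  + exact: Radon_Nikodym_SigmaFinite.f_integrable.
  + by apply/measurable_EFinP; exact: measurable_normal_pdf.
  + by move=> E _ mE; rewrite -Radon_Nikodym_SigmaFinite.f_integral.
Qed.

(** Tilting a centred Gaussian density by exp (a x^2) gives a multiple of the
    centred Gaussian density of standard deviation c s. All the moments below are
    read off this formula. *)
Lemma normal_expR_sq (s c : R) : 0 < s -> 0 < c ->
  (\int[normal_prob 0 s]_x (expR ((1 - c ^- 2) / (2 * s ^+ 2) * x ^+ 2))%:E = c%:E)%E.
Proof.
move=> s0 c0.
rewrite ge0_integral_normal_prob; last 2 first.
- apply/measurable_EFinP; apply: measurableT_comp => //.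
  by apply: measurable_funM => //; exact: measurable_funX.
- by move=> x; rewrite lee_fin expR_ge0.
rewrite (_ : (fun x => _)%E = (fun x => c%:E * (normal_pdf 0 (c * s) x)%:E)%E).
  rewrite ge0_integralZl//.
  - by rewrite integral_normal_pdf mule1.
  - by apply/measurable_EFinP; exact: measurable_normal_pdf.
  - by move=> x _; rewrite lee_fin normal_pdf_ge0.
  - by rewrite lee_fin ltW.
apply/funext => x; rewrite -!EFinM; congr EFin.
rewrite !normal_pdfE ?gt_eqF ?mulr_gt0//.
have -> : normal_peak s = c * normal_peak (c * s).
  have E : (c * s) ^+ 2 * pi *+ 2 = c ^+ 2 * (s ^+ 2 * pi *+ 2) by ring.
  rewrite /normal_peak E (sqrtrM _ (sqr_ge0 c)) sqrtr_sqr gtr0_norm// invfM.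
  by rewrite mulrA divff ?gt_eqF// mul1r.
rewrite mulrCA -!mulrA; congr (_ * (_ * _)).
rewrite /normal_fun -expRD; congr expR.
by rewrite subr0; field; rewrite !gt_eqF.
Qed.

Let mX (k : nat) : measurable_fun setT (fun x : R => (x ^+ k)%:E).
Proof. by apply/measurable_EFinP; exact: measurable_funX. Qed.

Let sq_ge0 (x : R) : (0 <= (x ^+ 2)%:E)%E.
Proof. by rewrite lee_fin sqr_ge0. Qed.

Let mexp (a : R) : measurable_fun setT (fun x : R => (expR (a * x ^+ 2))%:E).
Proof.
apply/measurable_EFinP; apply: measurableT_comp => //.
by apply: measurable_funM => //; exact: measurable_funX.
Qed.

(** The tilted integral with c = 2 dominates, since y^2 / 2 <= exp y for y >= 0. *)
Lemma normal_moment4_le (s : R) : 0 < s ->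
  (\int[normal_prob 0 s]_x (x ^+ 4)%:E <= (32 * s ^+ 4)%:E)%E.
Proof.
move=> s0.
have -> : ((32 * s ^+ 4)%:E = (16 * s ^+ 4)%:E * 2%:E)%E by rewrite -EFinM; congr EFin; ring.
rewrite -(normal_expR_sq s0 (ltr0n R 2)) -ge0_integralZl//; last 2 first.
- exact: mexp.
- by rewrite lee_fin mulr_ge0// exprn_ge0// ltW.
apply: ge0_le_integral => //.
- by move=> x _; rewrite lee_fin -[4%N]/(2 * 2)%N exprM sqr_ge0.
- exact: mX.
- by apply: emeasurable_funM; [exact: measurable_cst|exact: mexp].
move=> x _; rewrite -EFinM lee_fin.
set y := _ * x ^+ 2.
have y0 : 0 <= y.
  apply: mulr_ge0; last exact: sqr_ge0.
  apply: divr_ge0; last by rewrite mulr_ge0// sqr_ge0.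
  by rewrite subr_ge0 invf_le1 ?exprn_gt0// exprn_ege1// ler1n.
have yE : x ^+ 4 = (64 / 9) * s ^+ 4 * y ^+ 2.
  by rewrite /y; field; rewrite gt_eqF.
have e2 : y ^+ 2 / 2 <= expR y.
  by have := expR_ge1Dxn 1 y0; rewrite (_ : 2`! = 2)%N//; lra.
have S0 : 0 <= s ^+ 4 by rewrite exprn_ge0// ltW.
rewrite yE; have := sqr_ge0 y; move: (y ^+ 2) (expR y) (s ^+ 4) S0 e2.
by move=> a b S S0 ab a0; nra.
Qed.

(** The tilted integral equals c. Since 1 + y <= exp y, it is bounded below by an
    affine function of the second moment, for c on both sides of 1; the two bounds
    on the moment so obtained pinch as c tends to 1. *)
Lemma normal_moment2 (s : R) : 0 < s ->
  (\int[normal_prob 0 s]_x (x ^+ 2)%:E = (s ^+ 2)%:E)%E.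
Proof.
move=> s0; set I := (\int[_]_x _)%E.
have I0 : (0 <= I)%E by apply: integral_ge0.
have s20 : 0 < 2 * s ^+ 2 by rewrite mulr_gt0// exprn_gt0.
(* With a = (1 - c^-2) / (2 s^2), this is 1 + a x^2 <= exp (a x^2) integrated; the
   case c < 1 is written with - a so that all integrands are nonnegative. *)
have up c : 1 < c -> (1%:E + ((1 - c ^- 2) / (2 * s ^+ 2))%:E * I <= c%:E)%E.
  move=> c1; have c0 := lt_trans ltr01 c1.
  have a0 : 0 <= (1 - c ^- 2) / (2 * s ^+ 2).
    by rewrite divr_ge0 ?(ltW s20)// subr_ge0 invf_le1 ?exprn_gt0// exprn_ege1// ltW.
  rewrite -(normal_expR_sq s0 c0) -ge0_integralZl//; last exact: (mX 2).
  rewrite -[1%:E](probability_setT (normal_prob 0 s)) -[X in (X + _)%E]mul1e.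
  rewrite -(integral_cst (normal_prob 0 s) measurableT 1%E) -ge0_integralD//; last 2 first.
  - by move=> x _; rewrite mule_ge0// lee_fin.
  - by apply: emeasurable_funM => //; exact: mX.
  apply: ge0_le_integral => //.
  - by move=> x _; rewrite adde_ge0// mule_ge0// lee_fin.
  - by apply: emeasurable_funD => //; apply: emeasurable_funM => //; exact: mX.
  - exact: mexp.
  - by move=> x _; rewrite -EFinM -EFinD lee_fin expR_ge1Dx.
have dn c : 0 < c -> c < 1 -> (1%:E <= c%:E + ((c ^- 2 - 1) / (2 * s ^+ 2))%:E * I)%E.
  move=> c0 c1.
  have a0 : 0 <= (c ^- 2 - 1) / (2 * s ^+ 2).
    by rewrite divr_ge0 ?(ltW s20)// subr_ge0 invf_ge1 ?exprn_gt0// exprn_ile1// ltW.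
  rewrite -(normal_expR_sq s0 c0) -ge0_integralZl//; last exact: (mX 2).
  rewrite -[leLHS](probability_setT (normal_prob 0 s)) -[leLHS]mul1e.
  rewrite -(integral_cst (normal_prob 0 s) measurableT 1%E) -ge0_integralD//; last 3 first.
  - exact: mexp.
  - by move=> x _; rewrite mule_ge0// lee_fin.
  - by apply: emeasurable_funM => //; exact: mX.
  apply: ge0_le_integral => //.
  - by apply: emeasurable_funD; [exact: mexp|apply: emeasurable_funM => //; exact: mX].
  - move=> x _; rewrite -EFinM -EFinD lee_fin.
    have := expR_ge1Dx ((1 - c ^- 2) / (2 * s ^+ 2) * x ^+ 2).
    set e := expR _; rewrite (_ : (c ^- 2 - 1) / (2 * s ^+ 2) * x ^+ 2 =
      - ((1 - c ^- 2) / (2 * s ^+ 2) * x ^+ 2)); last by ring.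
    by lra.
have [m ImE] : exists m, I = m%:E.
  have h : (1 - 2 ^- 2) / (2 * s ^+ 2) > 0 :> R.
    by rewrite divr_gt0// subr_gt0 invf_lt1 ?exprn_gt0// exprn_egt1// ltr1n.
  move: I0 (up 2 (ltr1n R 2)); case: (I) => [m _ _|_|//]; first by exists m.
  by rewrite gt0_muley ?lte_fin// addey.
move: up dn I0; rewrite ImE lee_fin => up dn m0; congr EFin.
have {}up c : 1 < c -> (1 + c) * m <= 2 * c ^+ 2 * s ^+ 2.
  move=> c1; have := up _ c1; have c0 := lt_trans ltr01 c1.
  rewrite -EFinM -EFinD lee_fin => h.
  have c10 : 0 < c - 1 by rewrite subr_gt0.
  rewrite -(ler_pM2l c10) -subr_ge0.
  have -> : (c - 1) * (2 * c ^+ 2 * s ^+ 2) - (c - 1) * ((1 + c) * m) =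
    (2 * s ^+ 2 * c ^+ 2) * (c - (1 + (1 - c ^- 2) / (2 * s ^+ 2) * m)).
    by field; rewrite !gt_eqF.
  by rewrite mulr_ge0 ?subr_ge0// mulr_ge0 ?(ltW s20)// sqr_ge0.
have {}dn c : 0 < c -> c < 1 -> 2 * c ^+ 2 * s ^+ 2 <= (1 + c) * m.
  move=> c0 c1; have := dn _ c0 c1.
  rewrite -EFinM -EFinD lee_fin => h.
  have c10 : 0 < 1 - c by rewrite subr_gt0.
  rewrite -(ler_pM2l c10) -subr_ge0.
  have -> : (1 - c) * ((1 + c) * m) - (1 - c) * (2 * c ^+ 2 * s ^+ 2) =
    (2 * s ^+ 2 * c ^+ 2) * (c + (c ^- 2 - 1) / (2 * s ^+ 2) * m - 1).
    by field; rewrite !gt_eqF.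
  by rewrite mulr_ge0 ?subr_ge0// mulr_ge0 ?(ltW s20)// sqr_ge0.
clear ImE I; move: (exprn_gt0 2 s0) => {s20}; move: (s ^+ 2) up dn => S up dn S0.
(* Either strict inequality contradicts one of the bounds for c close to 1: c = 1 + e
   if S < m, and the midpoint c of m / S and 1 if m < S. *)
apply/eqP; rewrite eq_le; apply/andP; split; rewrite leNgt; apply/negP => h.
  pose e := (m - S) / (4 * m + 4 * S).
  have M0 : 0 < 4 * m + 4 * S by lra.
  have e0 : 0 < e by rewrite divr_gt0// subr_gt0.
  have e1 : e < 1 by rewrite ltr_pdivrMr//; lra.
  have eE : e * (4 * m + 4 * S) = m - S by rewrite divfK// gt_eqF.
  have := up (1 + e); rewrite ltrDl => /(_ e0) upe.
  have : e * ((2 + e) * (4 * m + 4 * S)) <= e * ((3 + 2 * e) * S).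
    rewrite mulrCA eE; lra.
  rewrite ler_pM2l// => {}upe.
  have eS : e * S < S by rewrite gtr_pMl.
  have em : 0 < e * (4 * m + 4 * S) by rewrite eE subr_gt0.
  lra.
pose c := (1 + m / S) / 2.
have q1 : m / S < 1 by rewrite ltr_pdivrMr// mul1r.
have q0 : 0 <= m / S by rewrite divr_ge0// ltW.
have c0 : 0 < c by rewrite /c; lra.
have c1 : c < 1 by rewrite /c; lra.
have := dn c c0 c1.
have {1}-> : m = (2 * c - 1) * S by rewrite /c; field; rewrite gt_eqF.
have : 0 < S * (1 - c) by rewrite mulr_gt0// subr_gt0.
lra.
Qed.

End normal_moments.

(** * Increments of Brownian motion *)

Section independence.
Context {R : realType} {d : measure_display} {Omega : measurableType d}
        {P : probability Omega R}.

(** The joint law of X and Y is the product of their laws, by uniqueness of the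
    product measure on rectangles; Tonelli's theorem then separates the variables. *)
Lemma integral_indep (X Y : Omega -> R) (f g : R -> \bar R) :
  measurable_fun setT X -> measurable_fun setT Y ->
  (forall A B : set R, measurable A -> measurable B ->
     P (X @^-1` A `&` Y @^-1` B) = (P (X @^-1` A) * P (Y @^-1` B))%E) ->
  measurable_fun setT f -> measurable_fun setT g ->
  (forall x, 0 <= f x)%E -> (forall x, 0 <= g x)%E ->
  (\int[P]_w (f (X w) * g (Y w)) = \int[P]_w f (X w) * \int[P]_w g (Y w))%E.
Proof.
move=> mX mY XY mf mg f0 g0.
have mXY : measurable_fun setT (fun w => (X w, Y w)) by exact: measurable_fun_pair.
pose X' : {mfun Omega >-> R} := mfun_Sub (mem_set mX).
pose Y' : {mfun Omega >-> R} := mfun_Sub (mem_set mY).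
pose XY' : {mfun Omega >-> (R * R)%type} := mfun_Sub (mem_set mXY).
pose h (z : R * R) := (f z.1 * g z.2)%E.
have mh : measurable_fun setT h.
  by apply: emeasurable_funM; apply: measurableT_comp.
have h0 z : (0 <= h z)%E by rewrite mule_ge0.
rewrite -[LHS](ge0_integral_distribution (XY' : {RV P >-> _}) mh h0).
rewrite (eq_measure_integral (distribution P X' \x distribution P Y')%E); last first.
  move=> A mA _; apply/esym.
  by apply: product_measure_unique => // B C mB mC; exact: XY.
rewrite fubini_tonelli1// /fubini_F /h /=.
under eq_integral do rewrite ge0_integralZl//.
rewrite ge0_integralZr//; last exact: integral_ge0.
by rewrite (ge0_integral_distribution (X' : {RV P >-> _}) mf f0) (ge0_integral_distribution (Y' : {RV P >-> _}) mg g0).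
Qed.

End independence.

Section brownian_increments.
Context {R : realType} {d : measure_display} {Omega : measurableType d}
        {P : probability Omega R}.
Variable W : R -> {RV P >-> R}.
Hypothesis hW : wiener_process W.
Implicit Types u v : R.

Definition increment u v (w : Omega) : R := W v w - W u w.

Lemma measurable_increment u v : measurable_fun setT (increment u v).
Proof. by apply: measurable_funB; exact: measurable_funPT. Qed.

Lemma integral_increment u v (f : R -> \bar R) : 0 <= u -> u < v ->
  measurable_fun setT f -> (forall x, 0 <= f x)%E ->
  (\int[P]_w f (increment u v w) = \int[normal_prob 0 (Num.sqrt (v - u))]_x f x)%E.
Proof.
move=> u0 uv mf f0; have [_ _ law _] := hW.
have mI : @measurable_fun _ _ Omega (measurableTypeR R) setT (increment u v).
  exact: measurable_increment.
pose X : {mfun Omega >-> measurableTypeR R} := @mfun_Sub _ _ _ (measurableTypeR R) _ (mem_set mI).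
have mf' : measurable_fun (setT : set (measurableTypeR R)) f by exact: mf.
rewrite -[LHS](ge0_integral_distribution (X : {RV P >-> measurableTypeR R}) mf' f0).
by apply: eq_measure_integral => A mA _; exact: law.
Qed.

Let mX (k : nat) : measurable_fun setT (fun x : R => (x ^+ k)%:E).
Proof. by apply/measurable_EFinP; exact: measurable_funX. Qed.

Lemma increment_moment2 u v : 0 <= u -> u < v ->
  (\int[P]_w (increment u v w ^+ 2)%:E = (v - u)%:E)%E.
Proof.
move=> u0 uv; rewrite (@integral_increment u v (fun x => (x ^+ 2)%:E))//.
  by rewrite normal_moment2 ?sqrtr_gt0 ?subr_gt0// sqr_sqrtr ?subr_ge0// ltW.
by move=> x; rewrite lee_fin sqr_ge0.
Qed.

Lemma increment_moment4_le u v : 0 <= u -> u < v ->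
  (\int[P]_w (increment u v w ^+ 4)%:E <= (32 * (v - u) ^+ 2)%:E)%E.
Proof.
move=> u0 uv; rewrite (@integral_increment u v (fun x => (x ^+ 4)%:E))//; last first.
  by move=> x; rewrite lee_fin -[4%N]/(2 * 2)%N exprM sqr_ge0.
rewrite (le_trans (normal_moment4_le _)) ?sqrtr_gt0 ?subr_gt0//.
by rewrite -[4%N]/(2 * 2)%N exprM sqr_sqrtr ?subr_ge0// ltW.
Qed.

(** The case n = 3 of the joint independence of the increments, the increment
    between v and u' being left arbitrary. *)
Lemma increment_indep u v u' v' (A B : set R) :
  0 <= u -> u <= v -> v <= u' -> u' <= v' -> measurable A -> measurable B ->
  P (increment u v @^-1` A `&` increment u' v' @^-1` B) =
  (P (increment u v @^-1` A) * P (increment u' v' @^-1` B))%E.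
Proof.
move=> u0 uv vu' uv' mA mB; have [_ _ _ ind] := hW.
pose t i := nth v' [:: u; v; u'; v'] i.
pose D i := nth setT [:: A; setT; B] i.
have := ind 3%N t D u0 _ _.
rewrite /= !big_ord_recl big_ord0 /= mule1 /t /D /=.
have -> : (fun w => W u' w - W v w) @^-1` setT = setT by [].
rewrite probability_setT mul1e => <-.
- congr (P _); apply/seteqP; split => w /=.
    by move=> [Aw Bw] [|[|[|]]].
  by move=> H; split; [exact: (H 0%N)|exact: (H 2%N)].
- by move=> [|[|[|[|i]]]] //=; rewrite !nth_nil.
- by move=> [|[|[|i]]] //=; rewrite nth_nil.
Qed.

End brownian_increments.

(** * Quadratic variation of Brownian motion *)

Section quadratic_variation.
Context {R : realType} {d : measure_display} {Omega : measurableType d}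
        {P : probability Omega R}.

Lemma measurable_psum (F : R -> R -> Omega -> R) (s t : R) (l : seq R) :
  itv_partition s t l ->
  (forall u v, s <= u -> u < v -> v <= t -> measurable_fun setT (F u v)) ->
  measurable_fun setT (fun w => partition_sum (fun u v => F u v w) s l).
Proof.
elim: l s => [s _ _|y l ih s slt mF].
  by under eq_fun do rewrite psum_nil; exact: measurable_cst.
have [sy yt yl] := itv_partition_step slt.
under eq_fun do rewrite psum_cons; apply: measurable_funD; first exact: mF.
by apply: ih => // u v yu; apply: mF; exact: le_trans (ltW sy) yu.
Qed.

Lemma measurable_ge_norm (f : Omega -> R) (e : R) : measurable_fun setT f ->
  measurable [set w | e <= `|f w|].
Proof.
move=> mf; have mn : measurable_fun setT (fun w => `|f w|) by exact: measurableT_comp.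
have := mn measurableT `[e, +oo[%classic (measurable_itv _).
rewrite setTI (_ : _ @^-1` _ = [set w | e <= `|f w|])//.
by apply/seteqP; split => w; rewrite /= in_itv/= andbT.
Qed.

Lemma integrable_bounded_moment (f : Omega -> R) (c : R) :
  measurable_fun setT f -> (forall w, 0 <= f w) ->
  (\int[P]_w (f w)%:E <= c%:E)%E -> P.-integrable setT (EFin \o f).
Proof.
move=> mf f0 fc; apply/integrableP; split; first exact/measurable_EFinP.
under eq_integral do rewrite /= ger0_norm//.
exact: le_lt_trans fc (ltry _).
Qed.

(** Chebyshev's inequality at level 2^-n gives probabilities of order 2^-n; the
    Borel-Cantelli lemma concludes. *)
Lemma ae_cvg0_of_sq_moments (X : nat -> Omega -> R) (c : R) :
  (forall n, measurable_fun setT (X n)) -> 0 <= c ->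
  (forall n, \int[P]_w (X n w ^+ 2)%:E <= (c / 8 ^+ n)%:E)%E ->
  {ae P, forall w, X n w @[n --> \oo] --> (0 : R)}.
Proof.
move=> mX c0 Xc.
pose A n := [set w | 2 ^- n <= `|X n w|].
have mA n : measurable (A n) by exact: measurable_ge_norm.
have PA n : (P (A n) <= (c / (2 ^ n)%:R)%:E)%E.
  have p0 : 0 < 4 ^- n :> R by rewrite invr_gt0 exprn_gt0.
  have : ((4 ^- n)%:E * P (A n) <= (c / 8 ^+ n)%:E)%E.
    apply: le_trans (Xc n).
    rewrite -[P (A n)]mul1e -integral_cst// -ge0_integralZl//.
    rewrite integral_mkcond; apply: ge0_le_integral => //.
    - by move=> w _; rewrite patchE; case: ifPn => // _; rewrite mule1 lee_fin ltW.
    - by apply/(measurable_restrictT _ _).1 => //; rewrite mule1; exact: measurable_cst.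
    - by apply/measurable_EFinP; exact: measurable_funX.
    move=> w _; rewrite patchE; case: ifPn => [/set_mem|_]; last by rewrite lee_fin sqr_ge0.
    rewrite /A /= mule1 lee_fin => h.
    rewrite -[leRHS]ger0_norm ?sqr_ge0// normrX (_ : 4 ^- n = (2 ^- n) ^+ 2 :> R).
      by rewrite lerXn2r ?nnegrE// invr_ge0 exprn_ge0.
    by rewrite exprVn -exprM mulnC exprM; congr (_ ^- _); rewrite expr2; lra.
  rewrite muleC -lee_pdivlMr// => h; apply: le_trans h _.
  rewrite -EFinM lee_fin natrX (_ : 8 = 2 * 4 :> R); last by lra.
  rewrite exprMn; set a := 2 ^+ n; set b := 4 ^+ n.
  have a0 : a != 0 by rewrite expf_neq0.
  have b0 : b != 0 by rewrite expf_neq0.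
  by rewrite le_eqVlt; apply/orP; left; apply/eqP; field; rewrite a0 b0.
have limA : P (lim_sup_set A) = 0.
  apply: lim_sup_set_cvg0 => //.
  apply: (@le_lt_trans _ _ (2 * c)%:E); last exact: ltry.
  apply: le_trans (epsilon_trick0 xpredT _); last by rewrite mulr_ge0.
  apply: lee_nneseries => [//|n _]; apply: le_trans (PA n) _.
  rewrite lee_fin expnS natrM invfM le_eqVlt; apply/orP; left; apply/eqP.
  by field; rewrite pnatr_eq0 expn_eq0.
exists (lim_sup_set A); split => //.
  by apply: bigcapT_measurable => n; apply: bigcup_measurable => k _.
move=> w; apply: contra_notP => wA.
have [n /= nA] : exists n, forall k, (n <= k)%N -> `|X k w| < 2 ^- k.
  apply: contrapT => H; apply: wA => n _.
  move/forallNP : H => /(_ n) /existsNP[k] /not_implyP[nk] /negP; rewrite -leNgt => h.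
  by exists k.
apply/cvgrPdist_lt => e e0.
near=> k; rewrite sub0r normrN.
have nk : (n <= k)%N by near: k; exact: nbhs_infty_ge.
apply: (lt_trans (nA k nk)); near: k.
by apply: near_invX_lt => //; rewrite ltr1n.
Unshelve. all: by end_near. Qed.

End quadratic_variation.

Section brownian_quadratic_variation.
Context {R : realType} {d : measure_display} {Omega : measurableType d}
        {P : probability Omega R}.
Variable W : R -> {RV P >-> R}.
Hypothesis hW : wiener_process W.
Implicit Types (s t u v h : R) (l : seq R).

Let dev u v (w : Omega) : R := sq_increment_dev (fun r => W r w) u v.
Let sq u v (w : Omega) : R := increment W u v w ^+ 2.

Let msq u v : measurable_fun setT (sq u v).
Proof. by apply: measurable_funX; exact: measurable_increment. Qed.

Lemma measurable_sq_increment_dev u v : measurable_fun setT (fun w => sq_increment_dev (fun r => W r w) u v).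
Proof. by apply: measurable_funB => //; exact: msq. Qed.

Let isq u v : 0 <= u -> u < v -> P.-integrable setT (EFin \o sq u v).
Proof.
move=> u0 uv; apply: (integrable_bounded_moment (c := v - u)) => //.
  by move=> w; exact: sqr_ge0.
by rewrite (increment_moment2 hW u0 uv).
Qed.

Let isq2 u v : 0 <= u -> u < v -> P.-integrable setT (EFin \o (fun w => sq u v w ^+ 2)).
Proof.
move=> u0 uv; apply: (integrable_bounded_moment (c := 32 * (v - u) ^+ 2)).
- by apply: measurable_funX.
- by move=> w; exact: sqr_ge0.
- apply: le_trans (increment_moment4_le hW u0 uv); apply: ge0_le_integral => //.
  + by move=> w _; rewrite lee_fin sqr_ge0.
  + by apply/measurable_EFinP; apply: measurable_funX.
  + by apply/measurable_EFinP; apply: measurable_funX; exact: measurable_increment.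
  + by move=> w _; rewrite /sq -exprM.
Qed.

Let icst (c : R) : P.-integrable setT (EFin \o (fun _ : Omega => c)).
Proof. exact: finite_measure_integrable_cst. Qed.

Let Ecst (c : R) : \int[P]_(w in setT) c = c.
Proof.
rewrite Rintegral_cst// -[RHS]mulr1; congr (_ * _).
exact: (congr1 fine (probability_setT P)).
Qed.

Let Esq u v : 0 <= u -> u < v -> \int[P]_w sq u v w = v - u.
Proof. by move=> u0 uv; rewrite /Rintegral /sq (increment_moment2 hW u0 uv). Qed.

Let iB (f g : Omega -> R) : P.-integrable setT (EFin \o f) ->
  P.-integrable setT (EFin \o g) -> P.-integrable setT (EFin \o (fun w => f w - g w)).
Proof. by move=> fi gi; exact: (integrableB measurableT fi gi). Qed.

Let iD (f g : Omega -> R) : P.-integrable setT (EFin \o f) ->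
  P.-integrable setT (EFin \o g) -> P.-integrable setT (EFin \o (fun w => f w + g w)).
Proof. by move=> fi gi; exact: (integrableD measurableT fi gi). Qed.

Let iZ (c : R) (f : Omega -> R) : P.-integrable setT (EFin \o f) ->
  P.-integrable setT (EFin \o (fun w => c * f w)).
Proof. by move=> fi; exact: (integrableZl measurableT c fi). Qed.

Lemma sq_increment_dev_moment2 u v : 0 <= u -> u < v ->
  P.-integrable setT (EFin \o (fun w => dev u v w * dev u v w)) /\
  \int[P]_w (dev u v w * dev u v w) <= 32 * (v - u) ^+ 2.
Proof.
move=> u0 uv.
have E : (fun w => dev u v w * dev u v w) =
    (fun w => sq u v w ^+ 2 - 2 * (v - u) * sq u v w + (v - u) ^+ 2).
  by apply/funext => w; rewrite /dev /sq_increment_dev /sq /increment; ring.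
have i1 := isq2 u0 uv; have i2 := iZ (2 * (v - u)) (isq u0 uv).
rewrite E; split; first by apply: iD => //; exact: iB.
rewrite RintegralD//; last exact: iB.
rewrite RintegralB// RintegralZl ?isq// Ecst Esq//.
have : \int[P]_w (sq u v w ^+ 2) <= 32 * (v - u) ^+ 2.
  rewrite -lee_fin /Rintegral fineK; last exact: integrable_fin_num.
  apply: le_trans (increment_moment4_le hW u0 uv); apply: ge0_le_integral => //.
  - by move=> w _; rewrite lee_fin sqr_ge0.
  - by apply/measurable_EFinP; apply: measurable_funX.
  - by apply/measurable_EFinP; apply: measurable_funX; exact: measurable_increment.
  - by move=> w _; rewrite /sq -exprM.
by have := sqr_ge0 (v - u); lra.
Qed.

Lemma sq_increment_dev_uncorrelated u v u' v' : 0 <= u -> u < v -> v <= u' -> u' < v' ->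
  P.-integrable setT (EFin \o (fun w => dev u v w * dev u' v' w)) /\
  \int[P]_w (dev u v w * dev u' v' w) = 0.
Proof.
move=> u0 uv vu' uv'.
have u'0 : 0 <= u' by rewrite (le_trans u0)// (le_trans (ltW uv)).
have msqE : measurable_fun setT (fun x : R => (x ^+ 2)%:E).
  by apply/measurable_EFinP; exact: measurable_funX.
have E2 : (\int[P]_w (sq u v w * sq u' v' w)%:E = ((v - u) * (v' - u'))%:E)%E.
  rewrite EFinM -(increment_moment2 hW u0 uv) -(increment_moment2 hW u'0 uv').
  rewrite -(@integral_indep _ _ _ P (increment W u v) (increment W u' v')
    (fun x => (x ^+ 2)%:E) (fun x => (x ^+ 2)%:E)) //.
  - exact: measurable_increment.
  - exact: measurable_increment.
  - by move=> A B mA mB; apply: increment_indep => //; exact: ltW.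
  - by move=> x; rewrite lee_fin sqr_ge0.
  - by move=> x; rewrite lee_fin sqr_ge0.
have i1 : P.-integrable setT (EFin \o (fun w => sq u v w * sq u' v' w)).
  apply: (integrable_bounded_moment (c := (v - u) * (v' - u'))).
  - by apply: measurable_funM.
  - by move=> w; rewrite mulr_ge0// sqr_ge0.
  - by rewrite E2.
have E : (fun w => dev u v w * dev u' v' w) =
    (fun w => sq u v w * sq u' v' w - (v' - u') * sq u v w - (v - u) * sq u' v' w
      + (v - u) * (v' - u')).
  by apply/funext => w; rewrite /dev /sq_increment_dev /sq /increment; ring.
have i2 := iZ (v' - u') (isq u0 uv); have i3 := iZ (v - u) (isq u'0 uv').
have i12 := iB i1 i2; have i123 := iB i12 i3.
rewrite E; split; first exact: iD.
rewrite RintegralD// RintegralB// RintegralB// !RintegralZl ?isq// Ecst !Esq//.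
by rewrite {1}/Rintegral E2 /=; ring.
Qed.

Lemma itv_partition_nth_lt s t l (i j : nat) : itv_partition s t l ->
  (i < j)%N -> (j <= size l)%N -> nth s (s :: l) i < nth s (s :: l) j.
Proof.
move=> [pl _] ij jl; apply: (sorted_ltn_nth lt_trans s (s := s :: l)) => //.
- by rewrite inE /= ltnS ltnW// (leq_trans ij).
Qed.

(** For deterministic weights the deviations of the squared increments are
    uncorrelated, so that the second moment of their sum is the sum of the second
    moments. Each is at most 32 (v - u)^2 <= 32 h (v - u), by the fourth moment of
    the Gaussian law. *)
Lemma sq_moment_weighted_qv (f : R -> R) s t l h : 0 <= s -> itv_partition s t l ->
  mesh_lt h s l -> (forall u, `|f u| <= 1) ->
  (\int[P]_w (partition_sum (fun u v => f u * dev u v w) s l ^+ 2)%:E <= (32 * h * (t - s))%:E)%E.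
Proof.
move=> s0 slt slh f1.
pose p := nth s (s :: l).
have p0 (i : 'I_(size l)) : 0 <= p i.
  apply: (le_trans s0); have [->|i0] := posnP i; first by [].
  by apply/ltW; apply: (itv_partition_nth_lt slt (i := 0)) => //; exact: ltnW.
have pS (i : 'I_(size l)) : p i < p i.+1 by exact: (itv_partition_nth_lt slt).
have pij (i j : 'I_(size l)) : (i < j)%N -> p i.+1 <= p j.
  rewrite leq_eqVlt => /predU1P[->//|ij]; apply/ltW.
  by apply: (itv_partition_nth_lt slt) => //; exact: ltnW.
pose Y (i : 'I_(size l)) w := f (p i) * dev (p i) (p i.+1) w.
have YY i j : P.-integrable setT (EFin \o (fun w => Y i w * Y j w)) /\
    \int[P]_w (Y i w * Y j w) <= (i == j)%:R * (32 * (p i.+1 - p i) ^+ 2).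
  have YE : (fun w => Y i w * Y j w) =
      (fun w => f (p i) * f (p j) * (dev (p i) (p i.+1) w * dev (p j) (p j.+1) w)).
    by apply/funext => w; rewrite /Y; ring.
  rewrite YE; have [<-|] := eqVneq i j.
    have [i1 i2] := sq_increment_dev_moment2 (p0 i) (pS i); split; first exact: iZ.
    rewrite RintegralZl// mul1r; apply: le_trans i2.
    apply: ler_piMl; first by apply: Rintegral_ge0 => w _; rewrite -expr2 sqr_ge0.
    rewrite -expr2 -[_ ^+ 2]ger0_norm ?sqr_ge0// normrX -[leRHS](expr1n _ 2).
    by rewrite lerXn2r ?nnegrE.
  rewrite neq_ltn => /orP[ij|ji].
    have [i1 i2] := sq_increment_dev_uncorrelated (p0 i) (pS i) (pij _ _ ij) (pS j).
    by split; [exact: iZ|rewrite RintegralZl// i2 mulr0 mul0r].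
  have [i1 i2] := sq_increment_dev_uncorrelated (p0 j) (pS j) (pij _ _ ji) (pS i).
  rewrite (_ : (fun w => _) = (fun w => f (p i) * f (p j) *
    (dev (p j) (p j.+1) w * dev (p i) (p i.+1) w))); last first.
    by apply/funext => w; rewrite (mulrC (dev (p j) _ w)).
  by split; [exact: iZ|rewrite RintegralZl// i2 mulr0 mul0r].
have -> : (fun w => (partition_sum (fun u v => f u * dev u v w) s l ^+ 2)%:E) =
    (fun w => \sum_(i < size l) (\sum_(j < size l) (Y i w * Y j w)%:E))%E.
  apply/funext => w; rewrite expr2 /partition_sum mulr_suml -sumEFin; apply: eq_bigr => i _.
  by rewrite mulr_sumr -sumEFin.
rewrite integral_sum//; last first.
  by move=> i; apply: integrable_sum => // j _; exact: (YY i j).1.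
apply: (@le_trans _ _ (\sum_(i < size l) (32 * (p i.+1 - p i) ^+ 2)%:E)%E).
  apply: lee_sum => i _; rewrite integral_sum//; last by move=> j; exact: (YY i j).1.
  apply: (@le_trans _ _ (\sum_(j < size l) ((i == j)%:R * (32 * (p i.+1 - p i) ^+ 2))%:E)%E).
    apply: lee_sum => j _.
    rewrite -[leLHS]fineK; last by apply: integrable_fin_num => //; exact: (YY i j).1.
    by rewrite lee_fin; exact: (YY i j).2.
  rewrite sumEFin lee_fin (bigD1 i)//= eqxx mul1r big1 ?addr0// => j ji.
  by rewrite eq_sym (negbTE ji) mul0r.
rewrite sumEFin lee_fin.
have -> : 32 * h * (t - s) = partition_sum (fun u v => 32 * h * (v - u)) s l.
  by rewrite psumZ; congr (_ * _); exact/esym/(psum_telescope (fun u => u) slt).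
apply: (psum_le_mesh (F := fun u v => 32 * (v - u) ^+ 2) slt slh) => u v su uv vt uvh.
by rewrite -mulrA ler_pM2l// expr2 ler_pM2r ?subr_gt0// ltW.
Qed.

(** The quadratic variation of Brownian motion, almost surely along partitions of
    rapidly decreasing mesh and simultaneously for all the step weights. *)
Lemma ae_step_qv_cvg0 s t (l : nat -> seq R) : 0 <= s ->
  (forall n, itv_partition s t (l n)) -> (forall n, mesh_lt (8 ^- n) s (l n)) ->
  {ae P, forall w, forall N i : nat,
    partition_sum (fun u v => step_weight N i u * sq_increment_dev (fun r => W r w) u v) s (l n) @[n --> \oo]
      --> (0 : R)}.
Proof.
move=> s0 lP lm; apply: ae_foralln => N; apply: ae_foralln => i.
have st := itv_partition_le (lP 0%N).
apply: (@ae_cvg0_of_sq_moments _ _ _ _ _ (32 * (t - s))).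
- move=> n; apply: (measurable_psum (lP n)) => u v _ _ _; apply: measurable_funM => //.
  exact: measurable_sq_increment_dev.
- by rewrite mulr_ge0// subr_ge0.
- move=> n; rewrite (_ : _ / _ = 32 * 8 ^- n * (t - s)); last by rewrite mulrAC.
  apply: sq_moment_weighted_qv => // u.
  by rewrite /step_weight; case: eqP => _; rewrite ?normr0 ?normr1.
Qed.

End brownian_quadratic_variation.

(** * Convergence in probability along partitions *)

Section convergence_in_probability.
Context {R : realType} {d : measure_display} {Omega : measurableType d}
        {P : probability Omega R}.
Implicit Types (s t : R) (l : seq R).

(** The reverse Fatou inequality for events. *)
Lemma lim_sup_set_ge (A : nat -> set Omega) (e : R) :
  (forall n, measurable (A n)) -> (forall n, e%:E <= P (A n))%E ->
  (e%:E <= P (lim_sup_set A))%E.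
Proof.
move=> mA eA.
have mU n : measurable (\bigcup_(k in [set k | (n <= k)%N]) A k).
  by apply: bigcup_measurable => k _.
have := lim_sup_set_cvg P A mA _.
have PU : (P (\bigcup_(k in [set k | (0 <= k)%N]) A k) < +oo)%E.
  exact: (le_lt_trans (probability_le1 P (mU 0%N)) (ltry _)).
move=> /(_ PU) H.
rewrite -(cvg_lim (@ereal_hausdorff R) H).
apply: lime_ge; first by apply/cvg_ex; exists (P (lim_sup_set A)).
apply: nearW => n; apply: (le_trans (eA n)); apply: le_measure; rewrite ?inE//.
by move=> w Aw; exists n => /=.
Qed.

(** If convergence in probability fails at some e, there is a sequence of
    partitions of rapidly decreasing mesh along which the bad events all have
    probability more than e. Their upper limit has probability at least e, although
    it only contains points where there is no convergence. Hence the gains need only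
    be studied path by path along sequences of partitions. *)
Lemma cvg_in_prob_mesh_of_ae s t (S : seq R -> Omega -> R) (I : Omega -> R) :
  (forall l, itv_partition s t l -> measurable_fun setT (S l)) ->
  measurable_fun setT I ->
  (forall l : nat -> seq R, (forall n, itv_partition s t (l n)) ->
     (forall n, mesh_lt (8 ^- n) s (l n)) ->
     {ae P, forall w, S (l n) w @[n --> \oo] --> I w}) ->
  cvg_in_prob_mesh (P := P) s t S I.
Proof.
move=> mS mI SI e e0; apply: contrapT => H.
have K n : exists l, [/\ itv_partition s t l, mesh_lt (8 ^- n) s l &
    (e%:E < P [set w | (e <= `|S l w - I w|)%R])%E].
  apply: contrapT => nl; apply: H; exists (8 ^- n); first by rewrite invr_gt0 exprn_gt0.
  move=> l pl ml; rewrite leNgt; apply/negP => Pl; apply: nl.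
  by exists l.
have [l lP] := choice K.
have lp n : itv_partition s t (l n) by have [] := lP n.
pose A n := [set w | (e <= `|S (l n) w - I w|)%R].
have mA n : measurable (A n).
  by apply: measurable_ge_norm; apply: measurable_funB => //; exact: mS.
have eA n : (e%:E <= P (A n))%E by have [_ _ /ltW] := lP n.
have := lim_sup_set_ge mA eA.
have mlim : measurable (lim_sup_set A).
  by apply: bigcapT_measurable => n; apply: bigcup_measurable => k _.
suff -> : P (lim_sup_set A) = 0 by rewrite lee_fin leNgt e0.
have [|N [mN N0 HN]] := SI l lp; first by move=> n; have [] := lP n.
apply: (subset_measure0 mlim mN _ N0) => w Aw; apply: HN => /= cw.
move/cvgrPdist_lt : cw => /(_ e e0) [n _ H1].
have [k /= nk] := Aw n Logic.I.
by have := H1 k nk; rewrite /A /= distrC => ? ?; lra.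
Qed.

Lemma left_sumE (H X : R -> Omega -> R) s l w :
  left_sum H X s l w = partition_sum (fun u v => H u w * (X v w - X u w)) s l.
Proof. by []. Qed.

Lemma is_ito_integral0 (X : R -> Omega -> R) s t :
  is_ito_integral (P := P) (fun _ _ => 0) X s t (fun=> 0).
Proof.
split; first exact: measurable_cst.
move=> e e0; exists 1 => // l _ _.
rewrite (_ : [set w | _] = set0) ?measure0 ?lee_fin ?ltW//.
apply/seteqP; split => // w /=.
rewrite subr0 left_sumE /partition_sum big1 ?normr0; first by rewrite leNgt e0.
by move=> k _; rewrite mul0r.
Qed.

(** The sums all vanish, so that I is within 2^-n of 0 with probability at least
    1 - 2^-n; a partition exists for every mesh, which makes the condition
    nonvacuous. *)
Lemma is_ito_integral0_ae (X : R -> Omega -> R) s t I : s <= t ->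
  is_ito_integral (P := P) (fun _ _ => 0) X s t I -> {ae P, forall w, I w = 0}.
Proof.
move=> st [mI cI].
have AP n : (P [set w | (2 ^- n <= `|I w|)%R] <= (2 ^- n)%:E)%E.
  have p0 : 0 < 2 ^- n :> R by rewrite invr_gt0 exprn_gt0.
  have [h h0 H] := cI (2 ^- n) p0.
  have [l pl ml] := exists_fine_partition st h0.
  have := H l pl ml; congr (_ <= _)%E; congr (P _); apply/seteqP; split => w /=;
    by rewrite left_sumE /partition_sum big1 ?sub0r ?normrN// => k _; rewrite mul0r.
have B0 m : {ae P, forall w, ~ (2 ^- m <= `|I w|)}.
  exists [set w | 2 ^- m <= `|I w|]; split; first exact: measurable_ge_norm.
    apply/eqP; rewrite eq_le measure_ge0 andbT; apply/lee_addgt0Pr => e e0.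
    rewrite add0e.
    have [n /andP[mn ne]] : exists n, (m <= n)%N && (2 ^- n <= e).
      have [k _ Hk] := near_invX_lt (ltr1n R 2) e0.
      by exists (maxn m k); rewrite leq_maxl ltW// Hk//= leq_maxr.
    apply: (@le_trans _ _ (P [set w | (2 ^- n <= `|I w|)%R])).
      apply: le_measure; rewrite ?inE; try exact: measurable_ge_norm.
      move=> w /=; apply: le_trans; rewrite lef_pV2 ?posrE ?exprn_gt0//.
      by rewrite ler_eXn2l// ltr1n.
    by apply: (le_trans (AP n)); rewrite lee_fin.
  by move=> w /= /contrapT.
have := ae_foralln B0; apply: filterS => w H; apply: contrapT => /eqP Iw0.
have Iw_gt0 : 0 < `|I w| by rewrite normr_gt0.
have [k _ Hk] := near_invX_lt (ltr1n R 2) Iw_gt0.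
by apply: (H k); rewrite ltW// Hk/=.
Qed.

End convergence_in_probability.

(** * Functions of the past *)

Section adaptedness.
Context {R : realType} {d : measure_display} {Omega : measurableType d}
        {P : probability Omega R}.
Variable W : R -> {RV P >-> R}.
Implicit Types (u v : R) (X Y : Omega -> R).

Definition past_events u : set (set Omega) :=
  [set E | exists v (A : set R), [/\ 0 <= v, v <= u, measurable A & E = W v @^-1` A]].

(** Measurability for the sigma-algebra generated by the path up to time u, stated
    for a measurable space carried by that sigma-algebra so that the closure
    properties of measurable functions apply. *)
Definition past_measurable u X : Prop :=
  @measurable_fun _ _ (g_sigma_algebraType (past_events u)) R setT X.

Lemma past_measurableP u X : past_measurable u X ->
  forall A : set R, measurable A -> natural_filtration W u (X @^-1` A).
Proof. by move=> mX A mA; have := mX measurableT A mA; rewrite setTI. Qed.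

Lemma past_measurable_sub u X : past_measurable u X -> measurable_fun setT X.
Proof.
move=> mX _ A mA; rewrite setTI; have := past_measurableP mX mA.
apply: smallest_sub; first exact: sigma_algebra_measurable.
move=> _ [v [B [_ _ mB ->]]]; rewrite -[_ @^-1` _]setTI.
exact: measurable_funPT.
Qed.

Lemma past_measurableW u v (f : R -> R) : 0 <= v -> v <= u ->
  measurable_fun setT f -> past_measurable u (fun w => f (W v w)).
Proof.
move=> v0 vu mf _ A mA; rewrite setTI; apply: sub_sigma_algebra.
exists v, (f @^-1` A); split=> //.
by rewrite -[_ @^-1` _]setTI; exact: mf.
Qed.

Lemma past_measurableM u X Y : past_measurable u X -> past_measurable u Y ->
  past_measurable u (fun w => X w * Y w).
Proof. exact: measurable_funM. Qed.

Lemma past_measurableD u X Y : past_measurable u X -> past_measurable u Y ->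
  past_measurable u (fun w => X w + Y w).
Proof. exact: measurable_funD. Qed.

Lemma past_measurable_cst u c : past_measurable u (fun=> c).
Proof. exact: measurable_cst. Qed.

End adaptedness.

(** * Integrals of continuous functions *)

Section integrals_of_continuous_functions.
Context {R : realType}.
Local Notation leb := (@lebesgue_measure R).
Implicit Types (s t u v : R) (f F : R -> R).

Lemma cts_integrable s t f : cts_on s t f -> leb.-integrable `[s, t] (EFin \o f).
Proof.
move=> cf; apply: continuous_compact_integrable; first exact: segment_compact.
exact: cts_within.
Qed.

(** If f u > 0 then f exceeds f u / 2 on an interval around u, whose length bounds
    the integral from below. *)
Lemma Rintegral_cts_eq0 s t f u : cts_on s t f -> (forall v, 0 <= f v) ->
  \int[leb]_(v in `[s, t]) f v = 0 -> s < u -> u < t -> f u = 0.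
Proof.
move=> cf f0 I0 su ut; apply: contrapT => /eqP fu0.
have c0 : 0 < f u by rewrite lt_neqAle eq_sym fu0 f0.
have [h h0 H] := cts_unif cf (divr_gt0 c0 (ltr0n R 2)).
have ust : s <= u <= t by rewrite !ltW.
pose a := Num.max s (u - h / 2); pose b := Num.min t (u + h / 2).
have au : a < u by rewrite gt_max su; lra.
have ub : u < b by rewrite lt_min ut; lra.
have ifs := cts_integrable cf.
have sub : `[a, b] `<=` `[s, t].
  move=> v /=; rewrite !in_itv/= ge_max le_min => /andP[/andP[-> _] /andP[-> _]] //.
have E0 : (\int[leb]_(v in `[s, t]) (f v)%:E = 0)%E.
  move: I0; rewrite /Rintegral => /(congr1 (@EFin R)); rewrite fineK//.
  exact: integrable_fin_num.
have : (((f u) / 2 * (b - a))%:E <= \int[leb]_(v in `[s, t]) (f v)%:E)%E.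
  apply: (@le_trans _ _ (\int[leb]_(v in `[a, b]) (f v)%:E)%E); last first.
    apply: ge0_subset_integral => //; first exact: measurable_int ifs.
    by move=> v _; rewrite lee_fin.
  have -> : ((f u / 2 * (b - a))%:E = \int[leb]_(v in `[a, b]) (f u / 2)%:E)%E.
    rewrite integral_cst//= lebesgue_measure_itv/= lte_fin (lt_trans au ub).
    by rewrite -EFinD -EFinM.
  apply: ge0_le_integral => //.
  - by move=> v _; rewrite lee_fin divr_ge0.
  - have iab : leb.-integrable `[a, b] (EFin \o f) 
      by apply: cts_integrable => v vab; apply: cf; have := sub v; rewrite /= !in_itv/= => /(_ vab).
    exact: measurable_int iab.
  - move=> v /=; rewrite in_itv/= ge_max le_min => /andP[/andP[_ va] /andP[_ vb]].
    rewrite lee_fin; have : `|f v - f u| < f u / 2.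
      by apply: H => //; rewrite ltr_norml; apply/andP; split; lra.
    by rewrite ltr_norml => /andP[? _]; lra.
rewrite E0 lee_fin leNgt mulr_gt0 ?divr_gt0// subr_gt0.
exact: lt_trans au ub.
Qed.

Lemma is_derive_Rintegral a t f u : cts_on a t f -> a < u -> u < t ->
  is_derive u 1 (fun v => \int[leb]_(x in `[a, v]) f x) (f u).
Proof.
move=> cf au ut.
have [|d dE] := @continuous_FTC1_closed R f a u t ut (cts_integrable cf) au.
  by apply: cf; rewrite !ltW.
split; first exact: d.
by rewrite -derive1E; exact: dE.
Qed.

Lemma Rintegral_is_derive s t f F : s <= t -> cts_on s t f ->
  (forall u, s <= u <= t -> is_derive u 1 F (f u)) ->
  \int[leb]_(u in `[s, t]) f u = F t - F s.
Proof.
rewrite le_eqVlt => /predU1P[->|st] cf FE.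
  by rewrite set_itv1 Rintegral_set1 subrr.
have cF u : s <= u <= t -> {for u, continuous F}.
  by move=> ust; exact: is_derive1_continuous (FE u ust).
rewrite /Rintegral (continuous_FTC2 st (cts_within cf) (F := F)) //.
- split.
  + by move=> u; rewrite in_itv/= => /andP[su ut]; have [] := FE u; rewrite ?ltW.
  + by apply: cvg_at_right_filter; apply: cF; rewrite lexx ltW.
  + by apply: cvg_at_left_filter; apply: cF; rewrite lexx ltW.
- move=> u; rewrite in_itv/= => /andP[su ut]; rewrite derive1E.
  by have [] := FE u; rewrite ?ltW.
Qed.

End integrals_of_continuous_functions.

(** * The hedged portfolio as a process *)

Section hedged_portfolio.
Context {R : realType} {d : measure_display} {Omega : measurableType d}
        {P : probability Omega R}.
Variables (W : R -> {RV P >-> R}) (mu sigma beta r T : R) (C : R -> R -> R).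
Hypothesis hW : wiener_process W.
Hypothesis hC : ito_smooth T C.
Variables (rho s0 t0 : R).
Hypotheses (rho0 : 0 < rho) (s00 : 0 < s0) (st0 : s0 <= t0) (t0T : t0 < T).
Local Notation leb := (@lebesgue_measure R).

Let b := B_coef mu sigma beta.
Let db := dB_coef mu sigma beta.
Let z (u : R) (w : Omega) : R := b u * W u w.
Let G := pde_lhs r C b.

Let bE (u : R) : 0 < u -> is_derive u 1 b (db u).
Proof. exact: is_derive_B_coef. Qed.

Let cdb (u : R) : 0 < u -> {for u, continuous db}.
Proof. exact: dB_coef_continuous. Qed.

Let T_gt (u : R) : 0 < u -> u <= t0 -> 0 < u < T.
Proof. by move=> -> ut; rewrite (le_lt_trans ut t0T). Qed.

Lemma wiener_path_cts s t w : 0 < s -> cts_on s t (fun u => W u w).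
Proof.
move=> s0' u /andP[su _]; have [_ cW _ _] := hW.
have [cW' _] := (continuous_within_itvcyP _ _).1 (cW w).
by apply: cW'; rewrite in_itv/= andbT (lt_le_trans s0' su).
Qed.

Let cz s t w : 0 < s -> cts_on s t (fun u => z u w).
Proof.
move=> s0'; apply: (scaled_path_cts (@wiener_path_cts s t w s0') (db := db)) => u.
by move=> /andP[su _]; apply: bE; exact: lt_le_trans su.
Qed.

Let cG : cts_off0 T G.
Proof. exact: (cts_off0_pde_lhs hC bE). Qed.

Let rate (u : R) (w : Omega) : R :=
  expR (- r * u) * (cutoff rho (z u w) * (G (z u w) u * G (z u w) u)).

Let half : 0 < s0 / 2. Proof. by rewrite divr_gt0. Qed.

Let c_rate s t w : 0 < s -> t < T -> cts_on s t (fun u => rate u w).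
Proof.
move=> s0' tT u ust; apply: cvgM; first exact: expR_continuous_lin.
exact: (cutoff_path_continuous rho0 (cts_off0M cG cG) s0' tT (@cz s t w s0')).
Qed.

(** The integral starts before s0, so that s0 is an interior point of its domain. *)
Let cumul (u : R) (w : Omega) : R := \int[leb]_(v in `[s0 / 2, u]) rate v w.

Let is_derive_cumul (u : R) w : s0 <= u <= t0 -> is_derive u 1 (cumul^~ w) (rate u w).
Proof.
move=> /andP[su ut].
apply: (@is_derive_Rintegral R (s0 / 2) ((t0 + T) / 2) (rate^~ w) u).
- by apply: c_rate => //; have := t0T; lra.
- by have := s00; lra.
- by have := t0T; lra.
Qed.

(** The solution of V' = r V + (number of options) * (left-hand side of the
    equation) with V = 0 at s0, by variation of constants. *)
Definition wealth (u : R) (w : Omega) : R := expR (r * u) * (cumul u w - cumul s0 w).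

Let wealth_derive w (u : R) : s0 <= u <= t0 ->
  is_derive u 1 (wealth^~ w) (wealth_rate r rho C b (wealth u w) (z u w) u).
Proof.
move=> ust; have d1 := is_derive_cumul w ust; have d2 := is_derive_expR_lin r u.
rewrite /wealth; apply: is_derive_eq; rewrite /wealth_rate /wealth /rate -/G /GRing.scale /=.
rewrite mulNr expRN; set k := cumul _ _ - _; set e := expR _.
have e0 : e != 0 by rewrite gt_eqF ?expR_gt0.
by field.
Qed.

Let past_cutoff H u v : cts_off0 T H -> 0 < v -> v <= u -> u <= t0 ->
  past_measurable W u (fun w => cutoff rho (z v w) * H (z v w) v).
Proof.
move=> cH v0 vu ut.
apply: (past_measurableW (v := v) (f := fun x => cutoff rho (b v * x) * H (b v * x) v)) => //.
  exact: ltW.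
apply: continuous_measurable_fun => x.
apply: (@continuous_comp _ _ _ (fun x => b v * x) (fun y => cutoff rho y * H y v)).
  by apply: cvgM; [exact: cvg_cst|exact: cvg_id].
by apply: (cutoff_section_continuous rho0 cH); exact: T_gt (le_trans vu ut).
Qed.

Let past_z u : 0 < u -> past_measurable W u (z u).
Proof.
move=> u0; apply: (past_measurableW (v := u) (f := fun x => b u * x)) => //; first exact: ltW.
by apply: measurable_funM.
Qed.

(** The wealth at time u is a limit of Riemann sums that only involve the path up
    to time u. *)
Let past_wealth u : s0 <= u <= t0 -> past_measurable W u (wealth u).
Proof.
move=> /andP[su ut].
have /choice[l lP] : forall n : nat, exists l, itv_partition s0 u l /\ mesh_lt (8 ^- n) s0 l.
  move=> n; have [|l] := @exists_fine_partition R s0 u (8 ^- n) su.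
    by rewrite invr_gt0 exprn_gt0.
  by exists l.
have lp n : itv_partition s0 u (l n) by have [] := lP n.
have lm n : mesh_lt (8 ^- n) s0 (l n) by have [] := lP n.
pose S n w := partition_sum (fun p q => rate p w * (q - p)) s0 (l n).
have mS n : past_measurable W u (S n).
  apply: (@measurable_psum R _ (g_sigma_algebraType (past_events W u))
    (fun p q w => rate p w * (q - p)) _ _ _ (lp n)) => p q sp pq qu.
  apply: (past_measurableM (Y := fun=> q - p)); last exact: past_measurable_cst.
  apply: (past_measurableM (X := fun=> expR (- r * p))); first exact: past_measurable_cst.
  apply: (past_cutoff (cts_off0M cG cG)) => //; first exact: lt_le_trans sp.
  exact: le_trans (ltW pq) qu.
have cS w : S n w @[n --> \oo] --> cumul u w - cumul s0 w.
  have dI v : s0 <= v <= u -> is_derive v 1 (cumul^~ w) (rate v w).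
    by move=> /andP[sv vu]; apply: is_derive_cumul; rewrite sv (le_trans vu).
  have cr : cts_on s0 u (rate^~ w) by apply: c_rate => //; exact: le_lt_trans t0T.
  have n0 := ito_small_is_derive (fun=> 0) dI cr.
  have H := @ito_small_psum_cvg0 R s0 u (fun=> 0) l lp (mesh_lt_near lm) 0 _ _ n0.
  rewrite -[X in _ --> X]subr0.
  rewrite (_ : (fun n => S n w) = (fun n => (cumul u w - cumul s0 w) -
     partition_sum (fun p q => cumul q w - cumul p w - rate p w * (q - p)) s0 (l n))).
    apply: cvgB; [exact: cvg_cst|apply: H; apply: nearW => n].
    by rewrite /partition_sum big1// => k _; rewrite subrr expr0n.
  by apply/funext => n; rewrite psumB (psum_telescope (cumul^~ w) (lp n)) subKr.
apply: (past_measurableM (X := fun=> expR (r * u))); first exact: past_measurable_cst.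
exact: (measurable_fun_cvg mS (fun w _ => cS w)).
Qed.

Let phi u w := hedge_option r rho C b (z u w) u.
Let psi u w := hedge_stock r rho C b (z u w) u.
Let eta u w := hedge_bank r rho C b (wealth u w) (z u w) u.
Let drift u w := wealth_rate r rho C b (wealth u w) (z u w) u.

Let cwealth w : cts_on s0 t0 (wealth^~ w).
Proof. by move=> u ust; exact: is_derive1_continuous (wealth_derive w ust). Qed.

Let adapted_intro X : (forall u, s0 <= u <= t0 -> past_measurable W u (X u)) ->
  (forall w, cts_on s0 t0 (X^~ w)) -> continuous_adapted W s0 t0 X.
Proof.
move=> mX cX; split=> [u /mX mXu A mA|w]; first exact: past_measurableP.
exact: cts_within.
Qed.

Let ccut H w : cts_off0 T H -> cts_on s0 t0 (fun u => cutoff rho (z u w) * H (z u w) u).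
Proof. by move=> cH; exact: (cutoff_path_continuous rho0 cH s00 t0T (@cz s0 t0 w s00)). Qed.

Let cpsi : cts_off0 T (fun y u => - (G y u * partial_z C y u)).
Proof. by apply: cts_off0N; apply: cts_off0M => //; exact: (cts_off0_Cz hC). Qed.

Let pos u : s0 <= u <= t0 -> 0 < u.
Proof. by move=> /andP[su _]; exact: lt_le_trans su. Qed.

Let phi_adapted : continuous_adapted W s0 t0 phi.
Proof.
apply: adapted_intro => [u ust|w]; last exact: (@ccut _ w cG).
by apply: (past_cutoff cG) => //; [exact: pos|case/andP: ust].
Qed.

Let psi_adapted : continuous_adapted W s0 t0 psi.
Proof.
apply: adapted_intro => [u ust|w]; last exact: (@ccut _ w cpsi).
by apply: (past_cutoff cpsi) => //; [exact: pos|case/andP: ust].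
Qed.

Let cbank := cts_off0_bank hC bE (r := r).

Let past_eta u : s0 <= u <= t0 -> past_measurable W u (eta u).
Proof.
move=> ust; apply: (past_measurableM (Y := fun=> (expR (r * u))^-1)); last exact: past_measurable_cst.
apply: past_measurableD; first exact: past_wealth.
rewrite (_ : (fun w => - _) = (fun w => (-1) * (cutoff rho (z u w) *
    (G (z u w) u * (C (z u w) u - partial_z C (z u w) u * z u w))))).
  apply: (past_measurableM (X := fun=> -1)); first exact: past_measurable_cst.
  by apply: (past_cutoff cbank) => //; [exact: pos|case/andP: ust].
by apply/funext => w; rewrite mulN1r.
Qed.

Let eta_adapted : continuous_adapted W s0 t0 eta.
Proof.
apply: adapted_intro => [u ust|w u ust]; first exact: past_eta.
apply: cvgM.
  by apply: cvgB; [exact: cwealth|exact: (@ccut _ w cbank)].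
by apply: cvgV; [rewrite gt_eqF ?expR_gt0|exact: expR_continuous_lin].
Qed.

Let cdrift w : cts_on s0 t0 (drift^~ w).
Proof.
move=> u ust; apply: cvgD; last exact: (@ccut _ w (cts_off0M cG cG)).
by apply: cvgM; [exact: cvg_cst|exact: cwealth].
Qed.

Let drift_adapted : continuous_adapted W s0 t0 drift.
Proof.
apply: adapted_intro => [u ust|w]; last exact: cdrift.
apply: past_measurableD.
  by apply: (past_measurableM (X := fun=> r)); [exact: past_measurable_cst|exact: past_wealth].
by apply: (past_cutoff (cts_off0M cG cG)) => //; [exact: pos|case/andP: ust].
Qed.

Let valueE : portfolio_value W mu sigma beta r C phi psi eta = wealth.
Proof.
apply/funext => u; apply/funext => w.
rewrite /portfolio_value /option_process /bank_account Z_processE.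
exact: hedge_value.
Qed.

Let option_measurable u : 0 < u < T ->
  measurable_fun setT (option_process W mu sigma beta C u).
Proof.
move=> uT; have mC : measurable_fun setT (fun y => C y u).
  rewrite -(setUv [set (0 : R)]); apply/measurable_funU => //.
    by apply: measurableC; exact: measurable_set1.
  split; first exact: measurable_fun_set1.
  apply: open_continuous_measurable_fun.
    by apply: closed_openC; exact: closed_eq.
  move=> y; rewrite inE /= => /eqP y0.
  have [|[_ dz _] _] := hC (z := y) _ uT; first by rewrite normr_gt0.
  exact: derivable1_continuous dz.
apply: (measurableT_comp mC); rewrite (_ : Z_process _ _ _ _ _ = z u).
  by apply: (past_measurable_sub (u := u)); apply: past_z; case/andP: uT.
by apply/funext => w; exact: Z_processE.
Qed.

(** Along partitions of rapidly decreasing mesh the gains converge almost surely,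
    by the pathwise formula. *)
Lemma hedge_self_financing : self_financing W mu sigma beta r C phi psi eta s0 t0.
Proof.
rewrite /self_financing valueE => s t s0s st tt0.
have inst u : s <= u -> u <= t -> s0 <= u <= t0.
  by move=> su ut; rewrite (le_trans s0s su) (le_trans ut tt0).
have inT u : s <= u -> u <= t -> 0 < u < T.
  by move=> su ut; apply: T_gt; [exact/pos/inst|exact: le_trans tt0].
have spos : 0 < s by exact: lt_le_trans s0s.
have mz u : 0 < u -> measurable_fun setT (Z_process W mu sigma beta u).
  move=> u0; rewrite (_ : Z_process _ _ _ _ _ = z u).
    by apply: (past_measurable_sub (u := u)); exact: past_z.
  by apply/funext => w; exact: Z_processE.
apply: cvg_in_prob_mesh_of_ae => [l pl| |l lp lm].
- apply: measurable_funD; first apply: measurable_funD.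
  + apply: (@measurable_psum _ _ _ (fun u v w => phi u w * (option_process W mu sigma beta C v w
      - option_process W mu sigma beta C u w)) _ _ _ pl) => u v su uv vt.
    apply: measurable_funM; last first.
      apply: measurable_funB; apply: option_measurable; apply: inT => //.
      * exact: le_trans (ltW uv).
      * exact: le_trans (ltW uv) vt.
    apply: (past_measurable_sub (u := u)); apply: (past_cutoff cG) => //.
      by apply/pos/inst => //; exact: le_trans (ltW uv) vt.
    exact: le_trans (ltW uv) (le_trans vt tt0).
  + apply: (@measurable_psum _ _ _ (fun u v w => psi u w * (Z_process W mu sigma beta v w
      - Z_process W mu sigma beta u w)) _ _ _ pl) => u v su uv vt.
    have u0 := lt_le_trans spos su; have v0 := lt_trans u0 uv.
    apply: measurable_funM; last by apply: measurable_funB; exact: mz.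
    apply: (past_measurable_sub (u := u)); apply: (past_cutoff cpsi) => //.
    exact: le_trans (ltW uv) (le_trans vt tt0).
  + apply: (@measurable_psum _ _ _ (fun u v w => eta u w * (bank_account r v w
      - bank_account r u w)) _ _ _ pl) => u v su uv vt.
    apply: measurable_funM; last by rewrite /bank_account; exact: measurable_cst.
    apply: (past_measurable_sub (u := u)); apply: past_eta; apply: inst => //.
    exact: le_trans (ltW uv) vt.
- apply: measurable_funB; [apply: (past_measurable_sub (u := t))|apply: (past_measurable_sub (u := s))];
    apply: past_wealth; exact: inst.
- have := ae_step_qv_cvg0 hW (ltW spos) lp lm; apply: filterS => w qv.
  have VE u : s <= u <= t ->
      is_derive u 1 (wealth^~ w) (wealth_rate r rho C b (wealth u w) (b u * W u w) u).
    by move=> /andP[su ut]; apply: wealth_derive; exact: inst.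
  have H := @hedge_gains_cvg R T r rho C b db hC rho0 bE cdb s t (fun u => W u w)
    (wealth^~ w) l spos (le_lt_trans tt0 t0T) (@wiener_path_cts s t w spos) lp
    (mesh_lt_near lm) qv VE.
  rewrite (_ : (fun n => _) = (fun n => partition_sum (fun u v =>
    hedge_option r rho C b (b u * W u w) u * (C (b v * W v w) v - C (b u * W u w) u) +
    hedge_stock r rho C b (b u * W u w) u * (b v * W v w - b u * W u w) +
    hedge_bank r rho C b (wealth u w) (b u * W u w) u * (expR (r * v) - expR (r * u))) s (l n)))//.
  apply/funext => n; rewrite !left_sumE -!psumD; apply: (eq_psum (lp n)) => u v _ _ _.
  by rewrite /option_process !Z_processE.
Qed.

Let wealth_ito (f : R -> Omega -> R) : (forall u w, s0 <= u <= t0 -> f u w = drift u w) ->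
  ito_differential W wealth f (fun _ _ => 0) s0 t0.
Proof.
move=> fE s t s0s st tt0; exists (fun=> 0); first exact: is_ito_integral0.
apply: aeW => w; rewrite addr0; apply/esym.
have inst u : s <= u <= t -> s0 <= u <= t0.
  by move=> /andP[su ut]; rewrite (le_trans s0s su) (le_trans ut tt0).
transitivity (\int[leb]_(u in `[s, t]) drift u w).
  by apply: eq_Rintegral => u; rewrite inE/= in_itv/= => /inst; exact: fE.
apply: (Rintegral_is_derive (f := drift^~ w) (F := wealth^~ w)) => //.
- by move=> u /inst; exact: cdrift.
- by move=> u /inst; exact: wealth_derive.
Qed.

Hypothesis hNA : no_arbitrage W mu sigma beta r T C.

(** The value of the hedged portfolio is an absolutely continuous process: its
    drift is the wealth rate by construction and r times the wealth by absence of
    arbitrage. The difference is a continuous nonnegative function of time, whose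
    integral vanishes almost surely. *)
Lemma no_arbitrage_ae u : s0 < u -> u < t0 ->
  {ae P, forall w, cutoff rho (z u w) * (G (z u w) u * G (z u w) u) = 0}.
Proof.
move=> s0u ut0.
have := hNA s00 st0 t0T phi_adapted psi_adapted eta_adapted drift_adapted hedge_self_financing.
rewrite valueE /= => /(_ (wealth_ito (fun _ _ _ => erefl))).
move=> /(_ s0 t0 (lexx _) st0 (lexx _)) [I I0 HI].
have [J J0 HJ] := wealth_ito (fun _ _ _ => erefl) (lexx s0) st0 (lexx t0).
have I0' := is_ito_integral0_ae st0 I0; have J0' := is_ito_integral0_ae st0 J0.
apply: filterS2 (filterI I0' J0') (filterI HI HJ) => w [Iw Jw] [HIw HJw].
pose k v := cutoff rho (z v w) * (G (z v w) v * G (z v w) v).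
have ck : cts_on s0 t0 k by exact: (@ccut _ w (cts_off0M cG cG)).
have crw : cts_on s0 t0 (fun v => r * wealth v w).
  by move=> v vst; apply: cvgM; [exact: cvg_cst|exact: cwealth].
apply: (Rintegral_cts_eq0 ck) => //.
  by move=> v; rewrite /k mulr_ge0 ?cutoff_ge0// -expr2 sqr_ge0.
move: HIw HJw; rewrite Iw Jw !addr0 => -> .
rewrite /drift /wealth_rate RintegralD//; [|exact: cts_integrable..].
by move=> /eqP; rewrite -subr_eq0 opprD addrA subrr sub0r oppr_eq0 => /eqP.
Qed.

End hedged_portfolio.

(** * The pricing equation *)

Section gaussian_positivity.
Context {R : realType}.

Lemma normal_prob_itv_neq0 (s a c : R) : 0 < s -> a < c -> normal_prob 0 s `[a, c] != 0%E.
Proof.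
move=> s0 ac; apply/eqP => H.
have sn0 : s != 0 by rewrite gt_eqF.
have cp : cts_on a c (normal_pdf 0 s) by move=> u _; exact: continuous_normal_pdf.
have /eqP : normal_pdf 0 s ((a + c) / 2) = 0.
  apply: (Rintegral_cts_eq0 cp); [by move=> v; exact: normal_pdf_ge0| |lra|lra].
  by move: H; rewrite /normal_prob /Rintegral => ->.
by rewrite gt_eqF// normal_pdfE// mulr_gt0 ?normal_peak_gt0// expR_gt0.
Qed.

End gaussian_positivity.

Section pricing_equation.
Context {R : realType} {d : measure_display} {Omega : measurableType d}
        {P : probability Omega R}.
Variables (W : R -> {RV P >-> R}) (mu sigma beta r T : R) (C : R -> R -> R).
Hypothesis hW : wiener_process W.
Hypothesis hC : ito_smooth T C.
Hypothesis hNA : no_arbitrage W mu sigma beta r T C.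

Let b := B_coef mu sigma beta.
Let G := pde_lhs r C b.

Let bE (u : R) : 0 < u -> is_derive u 1 b (dB_coef mu sigma beta u).
Proof. exact: is_derive_B_coef. Qed.

(** When b u <> 0 the price variation at time u has a Gaussian law of full
    support. A nonzero value of the left-hand side at (z, u) would persist on an
    interval around z, which is visited with positive probability. *)
Lemma pde_lhs_eq0_B_neq0 z u : 0 < `|z| -> 0 < u < T -> b u != 0 -> G z u = 0.
Proof.
move=> z0 uT bu; have /andP[u0 uT'] := uT; apply: contrapT => /eqP Gz.
pose rho := `|z| / 2.
have rho0 : 0 < rho by rewrite divr_gt0.
have cG : cts_off0 T G by exact: (cts_off0_pde_lhs hC bE).
(* Any period around u would do. *)
have [|||||N [mN N0 HN]] := @no_arbitrage_ae R d Omega P W mu sigma beta r T C hW hC rho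
  (u / 2) ((u + T) / 2) rho0 _ _ _ hNA u _ _; try lra.
pose k x := cutoff rho (b u * x) * (G (b u * x) u * G (b u * x) u).
pose x0 := z / b u.
have bx0 : b u * x0 = z by rewrite mulrC divfK.
have ck : {for x0, continuous k}.
  apply: (@continuous_comp _ _ _ (fun x => b u * x) (fun y => cutoff rho y * (G y u * G y u))).
    by apply: cvgM; [exact: cvg_cst|exact: cvg_id].
  exact: (cutoff_section_continuous rho0 (cts_off0M cG cG) uT).
(* k is the quantity that vanishes almost surely, as a function of W u. *)
have k0 : 0 < k x0.
  rewrite /k bx0 mulr_gt0//.
    by rewrite /cutoff lt_max; apply/orP; right; rewrite /rho; lra.
  by rewrite -expr2 lt_neqAle eq_sym sqrf_eq0 Gz sqr_ge0.
move: ck => /cvgrPdist_lt/(_ _ k0)/nbhs_ballP[e /= e0 He].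
have [_ _ law _] := hW.
have su0 : 0 < Num.sqrt u by rewrite sqrtr_gt0.
pose A : set R := `[x0 - e / 2, x0 + e / 2]%classic.
have mA : measurable A by exact: measurable_itv.
have : P (W u @^-1` A) = 0.
  apply: (subset_measure0 _ mN _ N0).
    by rewrite -[_ @^-1` _]setTI; exact: measurable_funPT.
  move=> w /=; rewrite /A /= in_itv/= => /andP[Aw wA]; apply: HN => /= H.
  have Hw : ball x0 e (W u w) by rewrite /ball /= ltr_norml; apply/andP; split; lra.
  by have := He _ Hw; rewrite /= {2}/k /G /b H subr0 gtr0_norm// ltxx.
have [W0 _ _ _] := hW.
rewrite (_ : W u @^-1` A = (fun w => W u w - W 0 w) @^-1` A); last first.
  by apply/seteqP; split => w /=; rewrite W0 subr0.
rewrite law// subr0 => /eqP; apply/negP; apply: normal_prob_itv_neq0 => //; lra.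
Qed.

Lemma B_coefM u : 0 < u -> b u * u `^ beta = drift_q mu sigma * u + sigma.
Proof.
move=> u0; rewrite /b /B_coef.
have -> : u `^ beta = u `^ (beta - 1) * u.
  by rewrite -{3}(powRr1 (ltW u0)) -powRD ?subrK// (gt_eqF u0) implybT.
by field; rewrite !gt_eqF ?powR_gt0.
Qed.

(** The coefficient b vanishes at one date at most, the root of q u + sigma; there
    the equation follows from the neighbouring dates by continuity. *)
Lemma pde_lhs_eq0 z u : (mu != 0) || (sigma != 0) -> 0 < `|z| -> 0 < u < T -> G z u = 0.
Proof.
move=> ms z0 uT; have [bu|bu] := eqVneq (b u) 0; last exact: pde_lhs_eq0_B_neq0.
have /andP[u0 uT'] := uT.
(* Two zeros of q u + sigma would give q = sigma = 0, hence mu = sigma = 0. *)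
have b_neq0 v : 0 < v -> v != u -> b v != 0.
  move=> v0 vu; apply/eqP => bv.
  have := B_coefM u0; have := B_coefM v0; rewrite bu bv !mul0r => Ev Eu.
  have : drift_q mu sigma * (v - u) = 0 by move: Ev Eu; lra.
  move/eqP; rewrite mulf_eq0 (subr_eq0 v u) (negbTE vu) orbF => /eqP q0.
  have sg : sigma = 0 by move: Eu; rewrite q0; lra.
  have m0 : mu = 0 by move: q0; rewrite /drift_q sg; lra.
  by move: ms; rewrite sg m0 eqxx.
apply: contrapT => /eqP Gz.
have cG : cts_off0 T G by exact: (cts_off0_pde_lhs hC bE).
have cGu : {for u, continuous (G z)}.
  apply: (@continuous2_cvg _ _ _ _ _ _ (fun=> z) id G); last 2 first.
  - exact: cvg_cst.
  - exact: cvg_id.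
  - exact: cG.
move: cGu => /cvgrPdist_lt/(_ `|G z u|); rewrite normr_gt0 => /(_ Gz).
move=> /nbhs_ballP[e /= e0 He].
pose v := u + Num.min (e / 2) ((T - u) / 2).
have m0 : 0 < Num.min (e / 2) ((T - u) / 2).
  by rewrite lt_min; apply/andP; split; lra.
have me : Num.min (e / 2) ((T - u) / 2) <= e / 2 by rewrite ge_min lexx.
have mT : Num.min (e / 2) ((T - u) / 2) <= (T - u) / 2 by rewrite ge_min lexx orbT.
have Hv : ball u e v by rewrite /ball /= ltr_norml /v; apply/andP; split; lra.
have vT : 0 < v < T by rewrite /v; apply/andP; split; lra.
have vu : v != u by rewrite /v gt_eqF//; lra.
have bv : b v != 0 by apply: b_neq0 vu; case/andP: vT.
by have := He _ Hv; rewrite /= (pde_lhs_eq0_B_neq0 z0 vT bv) subr0 ltxx.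
Qed.

End pricing_equation.

Theorem proposition6p1 (R : realType) (d : measure_display)
    (Omega : measurableType d) (P : probability Omega R)
    (W : R -> {RV P >-> R}) (mu sigma beta r K T : R) (C : R -> R -> R)
    (hbeta : 3 / 2 < beta) (hK : 0 < K) (hT : 0 < T)
    (hmusigma : (mu != 0) || (sigma != 0))
    (hW : wiener_process W)
    (hC : ito_smooth T C)
    (hcall : call_contract T K C)
    (hNA : no_arbitrage W mu sigma beta r T C) :
  [/\ forall z delta : R, 0 < `|z| -> 0 < delta < T ->
        partial_t C z delta + r * z * partial_z C z delta
        + 1 / 2 * B_coef mu sigma beta delta ^+ 2
          * partial_z (partial_z C) z delta
        - r * C z delta = 0,
      forall delta : R, 0 < delta < T -> C 0 delta = 0 &
      forall z : R, C z T = Num.max (`|z| - ln K) 0].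
Proof.
have [payoff at0] := hcall; split.
- by move=> z u z0 uT; exact: (pde_lhs_eq0 hW hC hNA hmusigma z0 uT).
- exact: at0.
- move=> z; rewrite payoff /call_payoff maxC maxEle subr_ge0; case: (ltgtP (ln K) `|z|) => //.
  by move=> ->; rewrite subrr.
Qed.
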